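(* Let $f\in\mathcal{U}$ be of the form $f(z)=z+a_2z^2+a_3z^3+\cdots$. Then (i) $|a_4-a_2^3|\le 4$; (ii) $|a_5-a_2^4|\le 11$. These inequalities are sharp in the class $\mathcal{U}$, with equality in both (i) and (ii) for the Koebe function $k(z)=\frac{z}{(1-z)^2}=z+\sum_{n=2}^{\infty}nz^n$ and its rotations $e^{-i\theta}k(e^{i\theta}z)$, $\theta\in\mathbb{R}$.
   Context: Let $\mathbb{D}=\{z\in\mathbb{C}:|z|<1\}$ be the open unit disk, and let $\mathcal{A}$ be the class of functions $f$ analytic in $\mathbb{D}$ of the form $f(z)=z+a_2z^2+a_3z^3+\cdots$ (so $a_n$ denotes the $n$-th Taylor coefficient of $f$ at $0$, with $f(0)=0$, $f'(0)=1$). The class $\mathcal{U}$ is $$\mathcal{U}=\left\{f\in\mathcal{A}:\left|\left(\frac{z}{f(z)}\right)^2f'(z)-1\right|<1 \text{ for all } z\in\mathbb{D}\right\}.$$ Here $z/f(z)$ is understood to take the value $1$ at $z=0$ (removable singularity), and the condition includes that the expression is defined, i.e. $f(z)\neq 0$ for $z\in\mathbb{D}\setminus\{0\}$. *)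

(* Defs.v *)
From Stdlib Require Import Reals.
From Coquelicot Require Import Coquelicot.

Local Open Scope C_scope.

Definition unit_disk (z : C) : Prop := (Cmod z < 1)%R.

(* Holomorphy: since the disk is open, complex differentiability at its points
   does not depend on the values taken by the total function [f] outside it. *)
Definition analytic_on_disk (f : C -> C) : Prop :=
  forall z : C, unit_disk z ->
    @ex_derive C_AbsRing C_NormedModule f z.

(* [f z = z + a 2 * z ^ 2 + a 3 * z ^ 3 + ...] on the unit disk; the sequence
   [a] is then the sequence of Taylor coefficients of [f] at 0. *)
Definition has_expansion (f : C -> C) (a : nat -> C) : Prop :=
  a 0%nat = 0 /\ a 1%nat = 1 /\
  forall z : C, unit_disk z ->
    @is_pseries C_AbsRing C_NormedModule a z (f z).

Definition class_A (f : C -> C) : Prop :=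
  analytic_on_disk f /\ exists a : nat -> C, has_expansion f a.

(* The function [z / f z], extended by 1 over its removable singularity. *)
Definition z_over (f : C -> C) (z : C) : C :=
  if Ceq_dec z 0 then 1 else z / f z.

(* The nonvanishing clause is needed because division in [C] is total. *)
Definition class_U (f : C -> C) : Prop :=
  class_A f /\
  (forall z : C, unit_disk z -> z <> 0 -> f z <> 0) /\
  (forall z : C, unit_disk z ->
     (Cmod (z_over f z ^ 2 * C_derive f z - 1) < 1)%R).

Definition koebe (z : C) : C := z / (1 - z) ^ 2.

Definition cis (theta : R) : C := (cos theta, sin theta).

Definition rotation (theta : R) (f : C -> C) (z : C) : C :=
  cis (- theta) * f (cis theta * z).

(* Main.v *)
Require Import Defs.
From Stdlib Require Import Reals Lra Lia FunctionalExtensionality.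
From Coquelicot Require Import Coquelicot.

(** Write [f z = z * p z] with [p z = 1 + z * q z], where [q] is the power series
    with coefficients [a 2, a 3, ...].  Since [p] has no zero in the disk,
    [k = q / p] is holomorphic there, [1 / f z = 1 / z - k z], and the condition
    defining the class says exactly [|z ^ 2 * om z| < 1] for
    [om = - k' = (q ^ 2 - q') / p ^ 2].  Schwarz's lemma gives [|om| <= 1]
    ([schwarz_sq]), so [psi = a 2 - k], a primitive of [om] vanishing at 0, is
    1-Lipschitz ([disk_lipschitz]).  With [om z = c0 + c1 z + c2 z ^ 2 + ...] one finds
    [c0 = a 2 ^ 2 - a 3] and

      [a 4 - a 2 ^ 3 = - (2 * a 2 * c0 + c1 / 2)],
      [a 5 - a 2 ^ 4 = - (3 * a 3 * c0 + 2 * c0 ^ 2 + a 2 * c1 + c2 / 3)].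

    Both bounds follow from [|c1|, |c2| <= 1 - |c0| ^ 2], [|a 2| <= 2] and
    [|a 3| <= 3].

    The first two inequalities hold for every holomorphic function bounded by 1
    ([coeff_bound]).  They come from a mean value property: the mean over a circle
    [|z| = s] of a function holomorphic in a punctured disk does not depend on [s]
    ([circ_const]).  This form avoids contour integration, Cauchy's formula and the
    expansion of holomorphic functions in power series; it only needs the derivative to
    be continuous, which is clear for power series and is kept along all operations.

    For the last two, consider [h z = 1 / z + psi z = a 2 + 1 / f z], which omits the
    value [a 2].  A fixed point argument for [z = 1 / (w - psi z)] shows that [h] takes
    every value [w] with [|w| > 2] ([covered_far]), hence [|a 2| <= 2].  For
    [a 3 = a 2 ^ 2 - c0], apply [coeff_bound] to the difference quotient
    [(psi z - psi ze) / (z - ze)], which is bounded by 1 because [psi] is 1-Lipschitz: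
    every value [w = h ze] satisfies [|w ^ 2 - c0| <= 2 + 1 / |ze| ^ 2]
    ([covered_quadratic_bound]).  If [|a 2 ^ 2 - c0| > 3], then along a half-line
    issued from [a 2] on which [|w ^ 2 - c0|] stays above that of [a 2], the
    preimages of covered points stay in a fixed disk of radius less than 1, where the
    fixed point argument extends coverage by a uniform step ([covered_step]).
    Coverage thus comes from infinity down to [a 2], a contradiction
    ([omitted_bound]).

    The rotated Koebe functions have coefficients [n * u ^ (n - 1)] with [|u| = 1],
    and the two quantities become [- 4 * u ^ 3] and [- 11 * u ^ 4]. *)

Local Open Scope C_scope.
Implicit Types (z w c l m : C) (F G : C -> C).

(** * Calculus of complex functions with continuous derivative *)

Notation CU := (AbsRing_UniformSpace C_AbsRing).
Notation CV := (AbsRing_NormedModule C_AbsRing).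
Notation Ccont F z := (@continuous CU CU F z).
Notation Cder F z l := (@is_derive C_AbsRing CV F z l).

Lemma Cmod_minus_sym z w : Cmod (z - w) = Cmod (w - z).
Proof. rewrite <- Cmod_opp. f_equal. ring. Qed.

Lemma Cmod_triangle_minus z w : (Cmod (z - w) <= Cmod z + Cmod w)%R.
Proof. rewrite <- (Cmod_opp w). apply Cmod_triangle. Qed.

Lemma Cmod_triangle_rev z w : (Cmod z - Cmod w <= Cmod (z - w))%R.
Proof.
  pose proof (Cmod_triangle (z - w) w) as H.
  replace (z - w + w) with z in H by ring. lra.
Qed.

(** Turns a bound on the modulus into a bound on a real part, so that the real mean
    value theorem, real series and real integrals suffice everywhere below. *)
Lemma Cmod_dual (l : C) : exists e : C, Cmod e = 1%R /\ Re (e * l) = Cmod l.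
Proof.
  destruct (Ceq_dec l 0) as [->|Hl].
  - exists 1. rewrite Cmod_1, Cmod_0, Cmult_0_r. now split.
  - assert (H0 : (0 < Cmod l)%R) by now apply Cmod_gt_0.
    assert (H1 : RtoC (Cmod l) <> 0) by (intros E; apply RtoC_inj in E; lra).
    exists (Cconj l / Cmod l). split.
    + rewrite Cmod_div, Cmod_conj, Cmod_R, Rabs_pos_eq by (auto; lra). field. lra.
    + replace (Cconj l / Cmod l * l) with (RtoC (Cmod l)).
      apply re_RtoC.
      replace (Cconj l / Cmod l * l) with ((l * Cconj l) / Cmod l) by (field; auto).
      rewrite <- Cmod2_conj, RtoC_pow. field. auto.
Qed.

Lemma Ccont_eps F z :
  Ccont F z <-> forall eps : posreal, exists del : posreal, forall w,
    (Cmod (w - z) < del)%R -> (Cmod (F w - F z) < eps)%R.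
Proof.
  split.
  - intros H eps. destruct (H (ball (F z : CU) eps) (locally_ball _ _)) as [d Hd].
    exists d. intros w Hw. apply (Hd w). exact Hw.
  - intros H P [eps HP]. destruct (H eps) as [d Hd]. exists d. intros w Hw.
    apply HP. apply Hd. exact Hw.
Qed.

Lemma Ccont_mult F G z : Ccont F z -> Ccont G z -> Ccont (fun w => F w * G w) z.
Proof. exact (continuous_mult (K := C_AbsRing) (U := CU) F G z). Qed.
Lemma Ccont_plus F G z : Ccont F z -> Ccont G z -> Ccont (fun w => F w + G w) z.
Proof. exact (continuous_plus (U := CU) (K := C_AbsRing) (V := CV) F G z). Qed.
Lemma Ccont_opp F z : Ccont F z -> Ccont (fun w => - F w) z.
Proof. exact (continuous_opp (U := CU) (K := C_AbsRing) (V := CV) F z). Qed.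
Lemma Ccont_const c z : Ccont (fun _ => c) z.
Proof. exact (continuous_const (U := CU) (V := CU) c z). Qed.
Lemma Ccont_id z : Ccont (fun w => w) z.
Proof. exact (continuous_id (U := CU) z). Qed.
Lemma Ccont_comp F G z : Ccont F z -> Ccont G (F z) -> Ccont (fun w => G (F w)) z.
Proof. exact (continuous_comp (U := CU) (V := CU) (W := CU) F G z). Qed.

Lemma Cder_cont F z l : Cder F z l -> Ccont F z.
Proof.
  intros H. apply (filterdiff_continuous (K := C_AbsRing) (U := CV) (V := CV) F z).
  eexists. exact H.
Qed.

Lemma Cder_eps F z l :
  Cder F z l <-> forall eps : posreal, exists del : posreal, forall w,
    (Cmod (w - z) < del)%R -> (Cmod (F w - F z - l * (w - z)) <= eps * Cmod (w - z))%R.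
Proof.
  split.
  - intros [_ H] eps. specialize (H z (fun P HP => HP) eps). destruct H as [d Hd].
    exists d. intros w Hw. specialize (Hd w Hw).
    replace (l * (w - z)) with ((w - z) * l) by ring. exact Hd.
  - intros H. split. apply is_linear_scal_l.
    intros x Hx. apply (is_filter_lim_locally_unique (K := C_AbsRing) (V := CV)) in Hx. subst x.
    intros eps. destruct (H eps) as [d Hd]. exists d. intros w Hw.
    specialize (Hd w Hw). replace (l * (w - z)) with ((w - z) * l) in Hd by ring. exact Hd.
Qed.

Lemma Cder_ext_loc F G z l (d : posreal) :
  (forall w, (Cmod (w - z) < d)%R -> F w = G w) -> Cder F z l -> Cder G z l.
Proof.
  intros H. apply is_derive_ext_loc. exists d. intros w Hw. apply H. exact Hw.
Qed.

(** The two normed module structures on [C] have different balls but the same norm,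
    and differentiability only sees the norm. *)
Lemma Cder_is_derive F z l : Cder F z l -> @is_derive C_AbsRing C_NormedModule F z l.
Proof.
  intros [_ H]. split. apply is_linear_scal_l. exact H.
Qed.

Lemma Cder_unique F z l : Cder F z l -> C_derive F z = l.
Proof. intros H. apply is_C_derive_unique. now apply Cder_is_derive. Qed.

Lemma Cder_mult F G z l m :
  Cder F z l -> Cder G z m -> Cder (fun w => F w * G w) z (l * G z + F z * m).
Proof.
  intros HF HG. exact (is_derive_mult (K := C_AbsRing) F G z l m HF HG Cmult_comm).
Qed.
Lemma Cder_plus F G z l m :
  Cder F z l -> Cder G z m -> Cder (fun w => F w + G w) z (l + m).
Proof. exact (is_derive_plus (K := C_AbsRing) (V := CV) F G z l m). Qed.
Lemma Cder_opp F z l : Cder F z l -> Cder (fun w => - F w) z (- l).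
Proof. exact (is_derive_opp (K := C_AbsRing) (V := CV) F z l). Qed.
Lemma Cder_minus F G z l m :
  Cder F z l -> Cder G z m -> Cder (fun w => F w - G w) z (l - m).
Proof. intros HF HG. apply Cder_plus; auto. now apply Cder_opp. Qed.
Lemma Cder_const c z : Cder (fun _ => c) z (RtoC 0).
Proof. exact (is_derive_const (K := C_AbsRing) (V := CV) c z). Qed.
Lemma Cder_id z : Cder (fun w => w) z (RtoC 1).
Proof. exact (is_derive_id (K := C_AbsRing) z). Qed.
Lemma Cder_comp F G z l m :
  Cder F z l -> Cder G (F z) m -> Cder (fun w => G (F w)) z (l * m).
Proof. intros HF HG. exact (is_derive_comp (K := C_AbsRing) (V := CV) G F z m l HG HF). Qed.

Lemma Cinv_dist z w : z <> 0 -> (Cmod (w - z) < Cmod z / 2)%R ->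
  w <> 0 /\ (Cmod (/ w) <= 2 / Cmod z)%R.
Proof.
  intros Hz Hw. assert (H0 : (0 < Cmod z)%R) by now apply Cmod_gt_0.
  pose proof (Cmod_triangle_rev z (z - w)) as H.
  replace (z - (z - w)) with w in H by ring. rewrite Cmod_minus_sym in H.
  assert (Hw0 : w <> 0) by (apply Cmod_gt_0; lra).
  split; auto. rewrite Cmod_inv by auto.
  replace (2 / Cmod z)%R with (/ (Cmod z / 2))%R by (field; lra).
  apply Rinv_le_contravar; lra.
Qed.

Lemma Cder_inv z : z <> 0 -> Cder Cinv z (- / z ^ 2).
Proof.
  intros Hz. assert (H0 : (0 < Cmod z)%R) by now apply Cmod_gt_0.
  apply Cder_eps. intros eps.
  assert (H3 : (0 < Cmod z ^ 3)%R) by now apply pow_lt.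
  assert (Hd : (0 < Rmin (Cmod z / 2) (eps * Cmod z ^ 3 / 2))%R).
  { apply Rmin_pos. lra. apply Rdiv_lt_0_compat; [apply Rmult_lt_0_compat; auto; apply cond_pos | lra]. }
  exists (mkposreal _ Hd). intros w Hw. simpl in Hw.
  destruct (Cinv_dist z w Hz) as [Hw0 Hiw].
  { eapply Rlt_le_trans. apply Hw. apply Rmin_l. }
  replace (/ w - / z - - / z ^ 2 * (w - z)) with ((w - z) * (w - z) * (/ w) / (z * z))
    by (field; auto).
  rewrite Cmod_div, !Cmod_mult by (now apply Cmult_neq_0).
  assert (Hw2 : (Cmod (w - z) <= eps * Cmod z ^ 3 / 2)%R).
  { left. eapply Rlt_le_trans. apply Hw. apply Rmin_r. }
  set (r := Cmod (w - z)) in *. set (m := Cmod z) in *.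
  assert (Hr : (0 <= r)%R) by apply Cmod_ge_0.
  apply Rle_trans with (r * (eps * m ^ 3 / 2) * (2 / m) / (m * m))%R.
  - apply Rmult_le_compat_r. left. apply Rinv_0_lt_compat. apply Rmult_lt_0_compat; auto.
    apply Rmult_le_compat; auto using Cmod_ge_0. apply Rmult_le_pos; auto.
    apply Rmult_le_compat_l; auto.
  - right. field. lra.
Qed.

Lemma Cder_inv_comp F z l : Cder F z l -> F z <> 0 ->
  Cder (fun w => / F w) z (- l / F z ^ 2).
Proof.
  intros HF Hz. replace (- l / F z ^ 2) with (l * (- / F z ^ 2)) by (field; auto).
  apply Cder_comp; auto. now apply Cder_inv.
Qed.

Lemma Ccont_inv F z : Ccont F z -> F z <> 0 -> Ccont (fun w => / F w) z.
Proof.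
  intros HF Hz. apply Ccont_comp; auto. eapply Cder_cont. now apply Cder_inv.
Qed.

(** The derivative is required to be continuous: differentiation under the integral
    sign in [circ_const] then needs no further argument. *)
Definition hol (D : C -> Prop) (F : C -> C) : Prop :=
  exists F1 : C -> C, forall z, D z -> Cder F z (F1 z) /\ Ccont F1 z.

Lemma hol_cont D F z : hol D F -> D z -> Ccont F z.
Proof. intros [F1 H] Hz. eapply Cder_cont. apply H. auto. Qed.

Lemma hol_sub (D E : C -> Prop) F : (forall z, E z -> D z) -> hol D F -> hol E F.
Proof. intros HE [F1 H]. exists F1. auto. Qed.

Lemma hol_mult D F G : hol D F -> hol D G -> hol D (fun z => F z * G z).
Proof.
  intros [F1 HF] [G1 HG]. exists (fun z => F1 z * G z + F z * G1 z).
  intros z Hz. destruct (HF z Hz) as [HF1 HF2], (HG z Hz) as [HG1 HG2]. split.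
  - now apply Cder_mult.
  - apply Ccont_plus; apply Ccont_mult; eauto using Cder_cont.
Qed.
Lemma hol_plus D F G : hol D F -> hol D G -> hol D (fun z => F z + G z).
Proof.
  intros [F1 HF] [G1 HG]. exists (fun z => F1 z + G1 z).
  intros z Hz. destruct (HF z Hz), (HG z Hz).
  split. now apply Cder_plus. now apply Ccont_plus.
Qed.
Lemma hol_opp D F : hol D F -> hol D (fun z => - F z).
Proof.
  intros [F1 HF]. exists (fun z => - F1 z).
  intros z Hz. destruct (HF z Hz). split. now apply Cder_opp. now apply Ccont_opp.
Qed.
Lemma hol_minus D F G : hol D F -> hol D G -> hol D (fun z => F z - G z).
Proof. intros HF HG. apply hol_plus; auto. now apply hol_opp. Qed.
Lemma hol_const D c : hol D (fun _ => c).
Proof. exists (fun _ => 0). intros z _. split. apply Cder_const. apply Ccont_const. Qed.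
Lemma hol_id D : hol D (fun z => z).
Proof. exists (fun _ => 1). intros z _. split. apply Cder_id. apply Ccont_const. Qed.
Lemma hol_pow D F n : hol D F -> hol D (fun z => F z ^ n).
Proof.
  intros HF. induction n as [|n IH]. exact (hol_const D 1).
  exact (hol_mult D F (fun z => F z ^ n) HF IH).
Qed.
Lemma hol_inv D F : hol D F -> (forall z, D z -> F z <> 0) -> hol D (fun z => / F z).
Proof.
  intros [F1 HF] H0. exists (fun z => - F1 z * / F z ^ 2).
  intros z Hz. destruct (HF z Hz) as [H1 H2]. split.
  - apply Cder_inv_comp; auto.
  - apply Ccont_mult. now apply Ccont_opp. apply Ccont_inv.
    + apply (Ccont_mult F (fun w => F w * 1)); eauto using Cder_cont.
      apply Ccont_mult. eauto using Cder_cont. apply Ccont_const.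
    + apply Cpow_nz; auto.
Qed.
Lemma hol_div D F G : hol D F -> hol D G -> (forall z, D z -> G z <> 0) ->
  hol D (fun z => F z / G z).
Proof. intros. apply hol_mult; auto. now apply hol_inv. Qed.
Lemma hol_comp D E F G : hol D F -> hol E G -> (forall z, D z -> E (F z)) ->
  hol D (fun z => G (F z)).
Proof.
  intros [F1 HF] [G1 HG] HDE. exists (fun z => F1 z * G1 (F z)).
  intros z Hz. destruct (HF z Hz), (HG (F z) (HDE z Hz)). split.
  - now apply Cder_comp.
  - apply Ccont_mult; auto. apply Ccont_comp; eauto using Cder_cont.
Qed.

Ltac hol_tac :=
  cbv beta;
  lazymatch goal with
  | H : hol ?D ?F |- hol ?D ?F => exact H
  | |- hol ?D (fun z => z) => exact (hol_id D)
  | |- hol ?D (fun _ => ?c) => exact (hol_const D c)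
  | |- hol ?D (fun z => @?F z + @?G z) => apply (hol_plus D F G); hol_tac
  | |- hol ?D (fun z => @?F z - @?G z) => apply (hol_minus D F G); hol_tac
  | |- hol ?D (fun z => @?F z * @?G z) => apply (hol_mult D F G); hol_tac
  | |- hol ?D (fun z => @?F z / @?G z) => apply (hol_div D F G); [hol_tac|hol_tac|]
  | |- hol ?D (fun z => - @?F z) => apply (hol_opp D F); hol_tac
  | |- hol ?D (fun z => @?F z ^ ?n) => apply (hol_pow D F n); hol_tac
  | H : hol ?D ?F |- hol ?D (fun z => ?F z) => exact H
  | |- _ => idtac
  end.

(** * Complex power series converging in the unit disk *)

Notation Cser u l := (@is_series C_AbsRing C_NormedModule u l).

Lemma Re_sum_n (u : nat -> C) n :
  Re (@sum_n C_AbelianMonoid u n) = sum_n (fun k => Re (u k)) n.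
Proof.
  induction n as [|n IH]. now rewrite !sum_O.
  rewrite !sum_Sn, <- IH. reflexivity.
Qed.
Lemma Im_sum_n (u : nat -> C) n :
  Im (@sum_n C_AbelianMonoid u n) = sum_n (fun k => Im (u k)) n.
Proof.
  induction n as [|n IH]. now rewrite !sum_O.
  rewrite !sum_Sn, <- IH. reflexivity.
Qed.

Lemma Cser_iff (u : nat -> C) l :
  Cser u l <-> is_series (fun n => Re (u n)) (Re l) /\ is_series (fun n => Im (u n)) (Im l).
Proof.
  split.
  - intros H. split.
    + apply filterlim_ext with (fun n => fst (@sum_n C_AbelianMonoid u n)).
      intros n. apply Re_sum_n.
      eapply filterlim_comp. apply H.
      apply (continuous_fst (U := R_UniformSpace) (V := R_UniformSpace)).
    + apply filterlim_ext with (fun n => snd (@sum_n C_AbelianMonoid u n)).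
      intros n. apply Im_sum_n.
      eapply filterlim_comp. apply H.
      apply (continuous_snd (U := R_UniformSpace) (V := R_UniformSpace)).
  - intros [H1 H2] P [e He].
    assert (A : eventually (fun n => ball (Re l) e (sum_n (fun k => Re (u k)) n)))
      by exact (H1 _ (locally_ball (Re l) e)).
    assert (B : eventually (fun n => ball (Im l) e (sum_n (fun k => Im (u k)) n)))
      by exact (H2 _ (locally_ball (Im l) e)).
    unfold filtermap. refine (filter_imp _ _ _ (filter_and _ _ A B)).
    clear A B. intros n [A B]. apply He. split.
    + change (ball (Re l) e (Re (@sum_n C_AbelianMonoid u n))). now rewrite Re_sum_n.
    + change (ball (Im l) e (Im (@sum_n C_AbelianMonoid u n))). now rewrite Im_sum_n.
Qed.

Lemma Cser_ext (u v : nat -> C) l : (forall n, u n = v n) -> Cser u l -> Cser v l.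
Proof. intros H. apply is_series_ext. exact H. Qed.
Lemma Cser_plus (u v : nat -> C) l m :
  Cser u l -> Cser v m -> Cser (fun n => u n + v n) (l + m).
Proof. exact (is_series_plus (K := C_AbsRing) (V := C_NormedModule) u v l m). Qed.
Lemma Cser_scal c (u : nat -> C) l : Cser u l -> Cser (fun n => c * u n) (c * l).
Proof. exact (is_series_scal (K := C_AbsRing) (V := C_NormedModule) c u l). Qed.
Lemma Cser_decr (u : nat -> C) l : Cser u l -> Cser (fun n => u (S n)) (l - u 0%nat).
Proof.
  intros H. apply (is_series_incr_1 (K := C_AbsRing) (V := C_NormedModule)).
  match goal with |- is_series _ ?x => replace x with l end. exact H.
  change (l = l - u 0%nat + u 0%nat). ring.
Qed.
Lemma Cser_incr (u : nat -> C) l : Cser (fun n => u (S n)) l -> Cser u (u 0%nat + l).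
Proof.
  intros H. apply (is_series_decr_1 (K := C_AbsRing) (V := C_NormedModule)).
  match goal with |- is_series _ ?x => replace x with l end. exact H.
  change (l = u 0%nat + l + - u 0%nat). ring.
Qed.

Lemma Cser_abs (u : nat -> C) (b : nat -> R) :
  (forall n, (Cmod (u n) <= b n)%R) -> ex_series b -> exists l, Cser u l.
Proof.
  intros H Hb.
  assert (A : ex_series (fun n => Re (u n))).
  { apply (ex_series_le (V := R_CompleteNormedModule) _ b); auto.
    intros n. eapply Rle_trans; [|apply H]. apply re_le_Cmod. }
  assert (B : ex_series (fun n => Im (u n))).
  { apply (ex_series_le (V := R_CompleteNormedModule) _ b); auto.
    intros n. eapply Rle_trans; [|apply H].
    eapply Rle_trans; [|apply Rmax_Cmod]. apply Rmax_r. }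
  destruct A as [x A], B as [y B]. exists (x, y). apply Cser_iff. now split.
Qed.

Lemma Cser_norm_le (u : nat -> C) (b : nat -> R) l :
  Cser u l -> (forall n, (Cmod (u n) <= b n)%R) -> ex_series b -> (Cmod l <= Series b)%R.
Proof.
  intros Hl H Hb. destruct (Cmod_dual l) as [e [He <-]].
  apply Cser_scal with (c := e), Cser_iff in Hl. destruct Hl as [Hl _].
  apply is_series_unique in Hl. rewrite <- Hl.
  assert (Hn : forall n, (Rabs (Re (e * u n)%C) <= b n)%R).
  { intros n. eapply Rle_trans. apply re_le_Cmod. rewrite Cmod_mult, He, Rmult_1_l. apply H. }
  assert (Ha : ex_series (fun n => Rabs (Re (e * u n)))).
  { apply (ex_series_le (V := R_CompleteNormedModule) _ b); auto. intros n. change (Rabs (Rabs (Re (e * u n)%C)) <= b n)%R.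
    now rewrite Rabs_Rabsolu. }
  eapply Rle_trans. apply Rle_abs. eapply Rle_trans. apply Series_Rabs; auto.
  apply Series_le; auto. intros n. split; auto. apply Rabs_pos.
Qed.

Lemma is_pseries_Cser (a : nat -> C) z l :
  @is_pseries C_AbsRing C_NormedModule a z l <-> Cser (fun n => a n * z ^ n) l.
Proof.
  split; apply is_series_ext; intros n; [exact (Cmult_comm (z ^ n) (a n))|apply Cmult_comm].
Qed.

(** Phrased through the moduli, so that the theory of real power series gives absolute
    convergence in the disk and its stability under shift and differentiation. *)
Definition disk_coeffs (a : nat -> C) : Prop :=
  Rbar_le 1 (CV_radius (fun n => Cmod (a n))).

Definition Cpseries (a : nat -> C) (z : C) : C :=
  (Series (fun n => Re (a n * z ^ n)), Series (fun n => Im (a n * z ^ n))).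

Lemma Cpseries_unique a z l : Cser (fun n => a n * z ^ n) l -> Cpseries a z = l.
Proof.
  intros [A B]%Cser_iff. apply is_series_unique in A, B.
  apply injective_projections; assumption.
Qed.

Lemma disk_coeffs_abs a r : disk_coeffs a -> (0 <= r < 1)%R ->
  ex_series (fun n => Cmod (a n) * r ^ n)%R.
Proof.
  intros Ha Hr. apply ex_series_ext with (fun n => Rabs (Cmod (a n) * r ^ n)).
  - intros n. apply Rabs_pos_eq. apply Rmult_le_pos. apply Cmod_ge_0. apply pow_le; lra.
  - apply CV_disk_inside. eapply Rbar_lt_le_trans; [|apply Ha].
    simpl. rewrite Rabs_pos_eq; lra.
Qed.

Lemma Cpseries_correct a z : disk_coeffs a -> unit_disk z -> Cser (fun n => a n * z ^ n) (Cpseries a z).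
Proof.
  intros Ha Hz. destruct (Cser_abs (fun n => a n * z ^ n) (fun n => Cmod (a n) * Cmod z ^ n)%R)
    as [l Hl].
  - intros n. rewrite Cmod_mult, Cmod_pow. apply Rle_refl.
  - apply disk_coeffs_abs; auto. split; auto. apply Cmod_ge_0.
  - now rewrite (Cpseries_unique _ _ _ Hl).
Qed.

(** The terms of a convergent series are bounded, and the radius of convergence is the
    supremum of the radii at which they are. *)
Lemma disk_coeffs_conv (a : nat -> C) :
  (forall x : R, (0 <= x < 1)%R -> exists l, Cser (fun n => a n * (x : C) ^ n) l) ->
  disk_coeffs a.
Proof.
  intros H. unfold disk_coeffs.
  destruct (CV_radius_bounded (fun n => Cmod (a n))) as [Hub _].
  assert (K : forall x, (0 <= x < 1)%R -> Rbar_le x (CV_radius (fun n => Cmod (a n)))).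
  { intros x Hx. apply Hub. destruct (H x Hx) as [l [A B]%Cser_iff].
    assert (A' := ex_series_lim_0 _ (ex_intro _ _ A)).
    assert (B' := ex_series_lim_0 _ (ex_intro _ _ B)).
    destruct (filterlim_bounded (V := R_NormedModule)
      (fun n => Re (a n * (x : C) ^ n)) (ex_intro _ 0%R A')) as [M1 HM1].
    destruct (filterlim_bounded (V := R_NormedModule)
      (fun n => Im (a n * (x : C) ^ n)) (ex_intro _ 0%R B')) as [M2 HM2].
    exists (M1 + M2)%R. intros n. specialize (HM1 n). specialize (HM2 n).
    change (Rabs (Re (a n * (x : C) ^ n)%C) <= M1)%R in HM1.
    change (Rabs (Im (a n * (x : C) ^ n)%C) <= M2)%R in HM2.
    replace (Rabs (Cmod (a n) * x ^ n)) with (Cmod (a n * (x : C) ^ n)).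
    - set (v := (a n * (x:C) ^ n)%C) in *.
      replace v with ((Re v : C) + Ci * (Im v : C)).
      eapply Rle_trans. apply Cmod_triangle.
      rewrite Cmod_mult, Cmod_Ci, !Cmod_R. lra.
      apply injective_projections; simpl; unfold Re, Im; ring.
    - rewrite Cmod_mult, Cmod_pow, Cmod_R, (Rabs_pos_eq x) by tauto.
      rewrite Rabs_pos_eq; auto.
      apply Rmult_le_pos. apply Cmod_ge_0. now apply pow_le. }
  destruct (CV_radius (fun n => Cmod (a n))) as [r| |].
  - simpl. destruct (Rle_lt_dec 1 r) as [?|Hr]; auto. exfalso.
    assert (H0 := K 0%R ltac:(lra)). simpl in H0.
    assert (H1 := K ((r + 1) / 2)%R ltac:(lra)). simpl in H1. lra.
  - exact I.
  - exact (K 0%R ltac:(lra)).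
Qed.

Definition shift_coeffs (a : nat -> C) (n : nat) : C := a (S n).
Definition deriv_coeffs (a : nat -> C) (n : nat) : C := INR (S n) * a (S n).

Lemma disk_coeffs_shift a : disk_coeffs a -> disk_coeffs (shift_coeffs a).
Proof.
  unfold disk_coeffs. intros H. rewrite <- CV_radius_decr_1 in H. exact H.
Qed.

Lemma disk_coeffs_deriv a : disk_coeffs a -> disk_coeffs (deriv_coeffs a).
Proof.
  unfold disk_coeffs. intros H. rewrite <- CV_radius_derive in H.
  erewrite CV_radius_ext. apply H. intros n. unfold deriv_coeffs, PS_derive.
  rewrite Cmod_mult, Cmod_R, Rabs_pos_eq; auto. apply pos_INR.
Qed.

Lemma Cpseries_shift a z : disk_coeffs a -> unit_disk z -> Cpseries a z = a 0%nat + z * Cpseries (shift_coeffs a) z.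
Proof.
  intros Ha Hz. apply Cpseries_unique.
  replace (a 0%nat) with (a 0%nat * z ^ 0) by (simpl; ring).
  apply (Cser_incr (fun n => a n * z ^ n)).
  apply Cser_ext with (fun n => z * (shift_coeffs a n * z ^ n)).
  - intros n. unfold shift_coeffs. simpl. ring.
  - apply Cser_scal. apply Cpseries_correct; auto. now apply disk_coeffs_shift.
Qed.

Lemma Cpseries_0 a : disk_coeffs a -> Cpseries a 0 = a 0%nat.
Proof.
  intros Ha. rewrite Cpseries_shift; auto. ring. unfold unit_disk. rewrite Cmod_0. lra.
Qed.

(** Remainder of order two in [z ^ (n + 1)], the building block of termwise
    differentiation. *)
Definition cslope (n : nat) (z w : C) : C :=
  w ^ S n - z ^ S n - INR (S n) * z ^ n * (w - z).

Lemma cslope_bound n z w r : (Cmod z <= r)%R -> (Cmod w <= r)%R ->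
  (Cmod (cslope (S n) z w) <= INR (S (S n)) * INR (S n) * r ^ n * Cmod (w - z) ^ 2)%R.
Proof.
  intros Hz Hw. assert (Hr : (0 <= r)%R) by (eapply Rle_trans; [apply Cmod_ge_0|eauto]).
  set (d := Cmod (w - z)).
  induction n as [|n IH].
  - replace (cslope 1 z w) with ((w - z) * (w - z)).
    rewrite Cmod_mult. fold d. simpl. pose proof (Cmod_ge_0 (w - z)). fold d in H. nra.
    unfold cslope. simpl. rewrite RtoC_plus. ring.
  - replace (cslope (S (S n)) z w)
      with (w * cslope (S n) z w + INR (S (S n)) * z ^ (S n) * ((w - z) * (w - z))).
    + eapply Rle_trans. apply Cmod_triangle. rewrite !Cmod_mult, Cmod_R, Cmod_pow. fold d.
      rewrite Rabs_pos_eq by apply pos_INR.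
      apply Rle_trans with (r * (INR (S (S n)) * INR (S n) * r ^ n * d ^ 2)
                            + INR (S (S n)) * r ^ (S n) * (d * d))%R.
      * apply Rplus_le_compat.
        apply Rmult_le_compat; auto using Cmod_ge_0.
        apply Rmult_le_compat_r. apply Rmult_le_pos; apply Cmod_ge_0.
        apply Rmult_le_compat_l. apply pos_INR. apply pow_incr. split; auto. apply Cmod_ge_0.
      * rewrite (S_INR (S (S n))), !S_INR. simpl.
        assert (P : (0 <= r * r ^ n * (d * d))%R).
        { apply Rmult_le_pos. apply Rmult_le_pos; auto. now apply pow_le.
          apply Rmult_le_pos; apply Cmod_ge_0. }
        pose proof (pos_INR n). nra.
    + unfold cslope. rewrite (S_INR (S (S n))), (S_INR (S n)).
      rewrite !RtoC_plus. simpl (_ ^ _). ring.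
Qed.

(** The second order remainder of the sum is dominated by [|w - z| ^ 2] times the
    majorant series of the second derivative on a slightly larger disk. *)
Lemma Cpseries_der a z : disk_coeffs a -> unit_disk z -> Cder (Cpseries a) z (Cpseries (deriv_coeffs a) z).
Proof.
  intros Ha Hz. unfold unit_disk in Hz. pose proof (Cmod_ge_0 z) as Hz0.
  set (r := ((1 + Cmod z) / 2)%R). assert (Hr : (Cmod z < r < 1)%R) by (unfold r; lra).
  set (b := fun n => (Cmod (deriv_coeffs (deriv_coeffs a) n) * r ^ n)%R).
  assert (Hb : ex_series b).
  { apply disk_coeffs_abs. now do 2 apply disk_coeffs_deriv. lra. }
  (* [b] is the majorant series of the second derivative on [|z| <= r]. *)
  assert (Key : forall w, (Cmod w <= r)%R ->
    (Cmod (Cpseries a w - Cpseries a z - Cpseries (deriv_coeffs a) z * (w - z)) <= Series b * Cmod (w - z) ^ 2)%R).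
  { intros w Hw.
    assert (S0 : Cser (fun n => a (S n) * cslope n z w)
               (Cpseries a w - Cpseries a z - Cpseries (deriv_coeffs a) z * (w - z))).
    { pose proof (Cpseries_correct a z Ha Hz) as Sz%Cser_decr.
      assert (unit_disk w) as Hw1 by (unfold unit_disk; lra).
      pose proof (Cpseries_correct a w Ha Hw1) as Sw%Cser_decr.
      pose proof (Cpseries_correct _ z (disk_coeffs_deriv a Ha) Hz) as Sd.
      apply Cser_scal with (c := - (w - z)) in Sd.
      apply Cser_scal with (c := - (1)) in Sz.
      pose proof (Cser_plus _ _ _ _ (Cser_plus _ _ _ _ Sw Sz) Sd) as HS.
      match type of HS with is_series _ ?x => replace x with
        (Cpseries a w - Cpseries a z - Cpseries (deriv_coeffs a) z * (w - z)) in HS by (simpl; ring) end.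
      revert HS. apply Cser_ext. intros n. unfold cslope, deriv_coeffs. simpl. ring. }
    apply Cser_decr in S0.
    replace (Cpseries a w - Cpseries a z - Cpseries (deriv_coeffs a) z * (w - z) - a 1%nat * cslope 0 z w)
      with (Cpseries a w - Cpseries a z - Cpseries (deriv_coeffs a) z * (w - z)) in S0
      by (unfold cslope; simpl; ring).
    rewrite <- Series_scal_r.
    apply (Cser_norm_le _ _ _ S0).
    - intros n. rewrite Cmod_mult. unfold b, deriv_coeffs. rewrite !Cmod_mult, !Cmod_R.
      rewrite !Rabs_pos_eq by apply pos_INR.
      eapply Rle_trans. apply Rmult_le_compat_l. apply Cmod_ge_0.
      apply (cslope_bound n z w r); lra.
      right. ring.
    - now apply ex_series_scal_r. }
  assert (HM : (0 <= Series b)%R).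
  { assert (E : forall n, b n = Rabs (b n)).
    { intros n. symmetry. apply Rabs_pos_eq. apply Rmult_le_pos. apply Cmod_ge_0.
      apply pow_le. lra. }
    rewrite (Series_ext _ _ E). eapply Rle_trans; [apply Rabs_pos|apply Series_Rabs].
    now apply (ex_series_ext b). }
  apply Cder_eps. intros eps.
  assert (Hd : (0 < Rmin (r - Cmod z) (eps / (Series b + 1)))%R).
  { apply Rmin_pos. lra. apply Rdiv_lt_0_compat. apply cond_pos. lra. }
  exists (mkposreal _ Hd). intros w Hw. simpl in Hw.
  eapply Rle_trans. apply Key.
  - pose proof (Cmod_triangle_rev w z). pose proof (Rmin_l (r - Cmod z) (eps / (Series b + 1))).
    lra.
  - simpl. rewrite Rmult_1_r, <- Rmult_assoc. apply Rmult_le_compat_r. apply Cmod_ge_0.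
    assert (H1 : (Cmod (w - z) <= eps / (Series b + 1))%R).
    { left. eapply Rlt_le_trans. apply Hw. apply Rmin_r. }
    apply Rle_trans with ((Series b + 1) * Cmod (w - z))%R.
    + apply Rmult_le_compat_r. apply Cmod_ge_0. lra.
    + apply Rmult_le_compat_l with (r := (Series b + 1)%R) in H1; [|lra].
      replace ((Series b + 1) * (eps / (Series b + 1)))%R with (pos eps) in H1 by (field; lra).
      exact H1.
Qed.

Lemma Cpseries_hol a : disk_coeffs a -> hol unit_disk (Cpseries a).
Proof.
  intros Ha. exists (Cpseries (deriv_coeffs a)). intros z Hz. split.
  - now apply Cpseries_der.
  - eapply Cder_cont. apply Cpseries_der; auto. now apply disk_coeffs_deriv.
Qed.

(** * Circle means of holomorphic functions *)

Lemma Cmod_le_Rabs z : (Cmod z <= Rabs (Re z) + Rabs (Im z))%R.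
Proof.
  replace z with ((Re z : C) + Ci * (Im z : C)) at 1.
  - eapply Rle_trans. apply Cmod_triangle. rewrite Cmod_mult, Cmod_Ci, !Cmod_R. lra.
  - apply injective_projections; simpl; unfold Re, Im; ring.
Qed.

Lemma cont_path (U : UniformSpace) (x y : U -> R) (u : U) G :
  continuous x u -> continuous y u -> Ccont G (x u, y u) ->
  continuous (fun v => Re (G (x v, y v))) u.
Proof.
  intros Hx Hy HG. apply filterlim_locally. intros eps.
  rewrite Ccont_eps in HG. destruct (HG eps) as [d Hd].
  assert (Hd2 : (0 < d / 2)%R) by (pose proof (cond_pos d); lra).
  pose proof (proj1 (filterlim_locally _ _) Hx (mkposreal _ Hd2)) as Hx'.
  pose proof (proj1 (filterlim_locally _ _) Hy (mkposreal _ Hd2)) as Hy'.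
  generalize (filter_and _ _ Hx' Hy'). apply filter_imp. intros v [A B].
  change (Rabs (Re (G (x v, y v)) - Re (G (x u, y u))) < eps)%R.
  apply Rle_lt_trans with (Cmod (G (x v, y v) - G (x u, y u))).
  - eapply Rle_trans; [|apply re_le_Cmod]. right. f_equal.
  - apply Hd. eapply Rle_lt_trans. apply Cmod_le_Rabs.
    change (Rabs (x v - x u) < d / 2)%R in A. change (Rabs (y v - y u) < d / 2)%R in B.
    simpl. unfold Rminus in A, B. lra.
Qed.

Lemma is_derive_eps (f : R -> R) t d : is_derive f t d ->
  forall eps : posreal, exists del : posreal, forall u, (Rabs (u - t) < del)%R ->
    (Rabs (f u - f t - d * (u - t)) <= eps * Rabs (u - t))%R.
Proof.
  intros [_ H] eps. specialize (H t (fun P HP => HP) eps). destruct H as [e He].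
  exists e. intros u Hu. specialize (He u Hu).
  replace (d * (u - t))%R with ((u - t) * d)%R by ring. exact He.
Qed.

(** Real parts along a path reduce the complex chain rule to ordinary real
    derivatives. *)
Lemma path_der (x y : R -> R) t d1 d2 F l :
  is_derive x t d1 -> is_derive y t d2 -> Cder F (x t, y t) l ->
  is_derive (fun u => Re (F (x u, y u))) t (Re (l * (d1, d2))).
Proof.
  intros Hx Hy HF. set (D := (d1, d2) : C).
  set (g := fun u => (x u, y u) : C). change (Cder F (g t) l) in HF.
  split. apply is_linear_scal_l.
  intros t0 Ht0. apply (is_filter_lim_locally_unique (K := R_AbsRing) (V := R_NormedModule)) in Ht0.
  subst t0. intros eps.
  pose proof (Cmod_ge_0 D) as HD. pose proof (Cmod_ge_0 l) as Hl.
  assert (H1 : (0 < eps / (2 * (Cmod D + 1)))%R).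
  { apply Rdiv_lt_0_compat. apply cond_pos. lra. }
  assert (H2 : (0 < Rmin (1 / 2) (eps / (4 * (Cmod l + 1))))%R).
  { apply Rmin_pos. lra. apply Rdiv_lt_0_compat. apply cond_pos. lra. }
  set (e1 := mkposreal _ H1). set (e2 := mkposreal _ H2).
  destruct (proj1 (Cder_eps _ _ _) HF e1) as [d Hd].
  destruct (is_derive_eps _ _ _ Hx e2) as [dx Hdx].
  destruct (is_derive_eps _ _ _ Hy e2) as [dy Hdy].
  assert (H3 : (0 < Rmin (Rmin dx dy) (d / (Cmod D + 1)))%R).
  { apply Rmin_pos. apply Rmin_pos; apply cond_pos. apply Rdiv_lt_0_compat. apply cond_pos. lra. }
  exists (mkposreal _ H3). intros u Hu.
  change (Rabs (u - t) < Rmin (Rmin dx dy) (d / (Cmod D + 1)))%R in Hu.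
  change (Rabs ((Re (F (g u)) - Re (F (g t))) - (u - t) * Re (l * D)%C) <= eps * Rabs (u - t))%R.
  pose proof (Rmin_l (Rmin dx dy) (d / (Cmod D + 1))) as M1.
  pose proof (Rmin_r (Rmin dx dy) (d / (Cmod D + 1))) as M2.
  pose proof (Rmin_l dx dy) as M3. pose proof (Rmin_r dx dy) as M4.
  specialize (Hdx u ltac:(lra)). specialize (Hdy u ltac:(lra)).
  set (k := Rabs (u - t)) in *. assert (Hk : (0 <= k)%R) by apply Rabs_pos.
  assert (E2 : (e2 <= 1 / 2)%R) by apply Rmin_l.
  assert (E2' : (e2 * (4 * (Cmod l + 1)) <= eps)%R).
  { assert (E : (e2 <= eps / (4 * (Cmod l + 1)))%R) by apply Rmin_r.
    apply Rmult_le_compat_r with (r := (4 * (Cmod l + 1))%R) in E; [|lra].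
    replace (eps / (4 * (Cmod l + 1)) * (4 * (Cmod l + 1)))%R with (pos eps) in E by (field; lra).
    exact E. }
  assert (E1 : (e1 * (2 * (Cmod D + 1)) = eps)%R) by (simpl; field; lra).
  clearbody e1 e2.
  assert (Hg : (Cmod (g u - g t - D * RtoC (u - t)) <= 2 * e2 * k)%R).
  { eapply Rle_trans. apply Cmod_le_Rabs. unfold g, D. simpl.
    replace (x u + - x t + - (d1 * (u - t) - d2 * 0))%R with (x u - x t - d1 * (u - t))%R by ring.
    replace (y u + - y t + - (d1 * 0 + d2 * (u - t)))%R with (y u - y t - d2 * (u - t))%R by ring.
    lra. }
  assert (Hg' : (Cmod (g u - g t) <= (Cmod D + 1) * k)%R).
  { replace (g u - g t) with ((g u - g t - D * RtoC (u - t)) + D * RtoC (u - t)) by ring.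
    eapply Rle_trans. apply Cmod_triangle. rewrite (Cmod_mult D), Cmod_R. fold k. nra. }
  assert (Hgd : (Cmod (g u - g t) < d)%R).
  { eapply Rle_lt_trans. apply Hg'.
    apply Rlt_le_trans with ((Cmod D + 1) * (d / (Cmod D + 1)))%R.
    apply Rmult_lt_compat_l; lra. right. field. lra. }
  specialize (Hd (g u) Hgd).
  replace (Re (F (g u)) - Re (F (g t)) - (u - t) * Re (l * D)%C)%R
    with (Re ((F (g u) - F (g t) - l * (g u - g t)) + l * (g u - g t - D * RtoC (u - t)))).
  - eapply Rle_trans. apply re_le_Cmod. eapply Rle_trans. apply Cmod_triangle.
    rewrite (Cmod_mult l).
    assert (e1 * Cmod (g u - g t) <= e1 * ((Cmod D + 1) * k))%R
      by (apply Rmult_le_compat_l; auto; left; apply cond_pos).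
    assert (Cmod l * Cmod (g u - g t - D * RtoC (u - t)) <= Cmod l * (2 * e2 * k))%R
      by (apply Rmult_le_compat_l; auto).
    assert (P : (0 <= e2 * k)%R) by (apply Rmult_le_pos; auto; left; apply cond_pos).
    assert (Cmod l * (2 * e2 * k) <= eps * k / 2)%R by nra.
    assert (e1 * ((Cmod D + 1) * k) = eps * k / 2)%R by (rewrite <- E1; field).
    lra.
  - replace (F (g u) - F (g t) - l * (g u - g t) + l * (g u - g t - D * RtoC (u - t)))
      with ((F (g u) + - F (g t)) + - (RtoC (u - t) * (l * D))) by ring.
    rewrite !re_plus, !re_opp, re_scal_l. ring.
Qed.

Definition circ (s t : R) : C := (s * cos t, s * sin t)%R.

Lemma Cmod_circ s t : (0 <= s)%R -> Cmod (circ s t) = s.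
Proof.
  intros Hs. unfold Cmod, circ. simpl.
  replace (s * cos t * (s * cos t * 1) + s * sin t * (s * sin t * 1))%R
    with (s * s * (Rsqr (sin t) + Rsqr (cos t)))%R by (unfold Rsqr; ring).
  rewrite sin2_cos2, Rmult_1_r. now apply sqrt_square.
Qed.

Lemma circ_cont_t s t G : Ccont G (circ s t) -> continuous (fun v => Re (G (circ s v))) t.
Proof.
  intros H. apply (cont_path R_UniformSpace (fun v => s * cos v)%R (fun v => s * sin v)%R); auto.
  - apply (ex_derive_continuous (fun v => s * cos v)%R). auto_derive. auto.
  - apply (ex_derive_continuous (fun v => s * sin v)%R). auto_derive. auto.
Qed.

Lemma circ_ex_RInt s G : (forall t, Ccont G (circ s t)) ->
  ex_RInt (fun t => Re (G (circ s t))) 0 (2 * PI).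
Proof.
  intros H. apply (ex_RInt_continuous (V := R_CompleteNormedModule)).
  intros t _. now apply circ_cont_t.
Qed.

(** On the circle [T' z * z] is, up to the factor [i], the derivative of [T] in the angle,
    and [T] returns to its initial value after one turn. *)
Lemma circ_der_RInt s T T1 :
  (forall t, Cder T (circ s t) (T1 (circ s t)) /\ Ccont T1 (circ s t)) ->
  is_RInt (fun t => Re (T1 (circ s t) * circ s t)) 0 (2 * PI) 0%R.
Proof.
  intros H.
  (* [- i * T] along the circle has angular derivative [T' z * z]. *)
  pose proof (is_RInt_derive (V := R_CompleteNormedModule)
    (fun t => Re (- Ci * T (circ s t))) (fun t => Re (T1 (circ s t) * circ s t)) 0 (2 * PI)) as K.
  replace 0%R with (minus (Re (- Ci * T (circ s (2 * PI)))) (Re (- Ci * T (circ s 0)))) at 2.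
  - apply K; clear K.
    + intros t _. destruct (H t) as [HT _].
      replace (Re (T1 (circ s t) * circ s t)) with
        (Re ((- Ci * T1 (circ s t)) * ((s * - sin t)%R, (s * cos t)%R))).
      * apply (path_der (fun v => s * cos v)%R (fun v => s * sin v)%R _ _ _ (fun z => - Ci * T z)).
        { auto_derive; auto. ring. }
        { auto_derive; auto. ring. }
        replace (- Ci * T1 (circ s t)) with (0 * T (circ s t) + - Ci * T1 (circ s t)) by ring.
        apply (Cder_mult (fun _ => - Ci)); auto. apply Cder_const.
      * unfold circ. simpl. ring.
    + intros t _. destruct (H t) as [_ HT].
      apply (circ_cont_t s t (fun z => T1 z * z)). apply Ccont_mult; auto. apply Ccont_id.
  - unfold circ. rewrite cos_2PI, sin_2PI, cos_0, sin_0. apply Rminus_diag_eq. reflexivity.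
Qed.

Definition punct (r : R) (z : C) : Prop := (0 < Cmod z < r)%R.

(** The derivative of the mean in the radius [s] is the mean of [Re (T' z * z) / s], which
    vanishes by [circ_der_RInt]. *)
Lemma circ_const T r s1 s2 : hol (punct r) T -> (0 < s1 < s2)%R -> (s2 < r)%R ->
  RInt (fun t => Re (T (circ s1 t))) 0 (2 * PI) = RInt (fun t => Re (T (circ s2 t))) 0 (2 * PI).
Proof.
  intros [T1 HT] Hs1 Hs2.
  assert (Hp : forall s t, (s1 / 2 < s < r)%R -> punct r (circ s t)).
  { intros s t Hs. unfold punct. rewrite Cmod_circ; lra. }
  assert (HD : forall s t, (s1 / 2 < s < r)%R ->
    is_derive (fun u => Re (T (circ u t))) s (Re (T1 (circ s t) * circ s t) / s)%R).
  { intros s t Hs. destruct (HT _ (Hp s t Hs)) as [H _].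
    replace (Re (T1 (circ s t) * circ s t) / s)%R with (Re (T1 (circ s t) * (cos t, sin t))).
    - apply (path_der (fun u => u * cos t)%R (fun u => u * sin t)%R); auto.
      + auto_derive; auto. ring.
      + auto_derive; auto. ring.
    - unfold circ. simpl. field. lra. }
  apply (eq_is_derive (fun s => RInt (fun t => Re (T (circ s t))) 0 (2 * PI))); [|lra].
  intros s Hs.
  assert (HL : locally s (fun u => (s1 / 2 < u < r)%R)).
  { apply (locally_interval _ s (s1/2)%R r); simpl; try lra. intros; lra. }
  assert (HI : RInt (fun t => Derive (fun u => Re (T (circ u t))) s) 0 (2 * PI) = 0%R).
  { rewrite (RInt_ext _ (fun t => (/ s * Re (T1 (circ s t) * circ s t)%C)%R)).
    - apply is_RInt_unique. replace 0%R with (/ s * 0)%R at 2 by apply Rmult_0_r.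
      apply (is_RInt_scal (V := R_NormedModule) (fun t => Re (T1 (circ s t) * circ s t))).
      apply (circ_der_RInt s T). intros t. apply HT. apply Hp. lra.
    - intros t _. erewrite is_derive_unique; [|apply HD; lra]. apply Rmult_comm. }
  pose proof (is_derive_RInt_param (fun s t => Re (T (circ s t))) 0 (2 * PI) s) as K.
  cbv beta in K. rewrite HI in K. apply K; clear K HI.
  - revert HL. apply filter_imp. intros u Hu t _. eexists. now apply HD.
  - intros t _. apply continuity_2d_pt_ext_loc with
      (fun u v => Re (T1 (circ u v) * circ u v) / u)%R.
    + destruct HL as [e He]. exists e. intros u v Hu Hv. symmetry.
      apply is_derive_unique. apply HD. now apply He.
    + apply (continuity_2d_pt_mult (fun u v => Re (T1 (circ u v) * circ u v))
        (fun u v => / u)%R).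
      * apply continuity_2d_pt_filterlim.
        refine (cont_path (prod_UniformSpace R_UniformSpace R_UniformSpace)
          (fun z => fst z * cos (snd z))%R (fun z => fst z * sin (snd z))%R (s, t)
          (fun z => T1 z * z) _ _ _).
        { apply (proj1 (continuity_2d_pt_filterlim (fun u v => u * cos v)%R s t)).
          apply (continuity_2d_pt_mult (fun u _ => u) (fun _ v => cos v)).
          apply continuity_2d_pt_id1.
          apply (continuity_1d_2d_pt_comp cos (fun _ v => v)).
          apply continuity_cos. apply continuity_2d_pt_id2. }
        { apply (proj1 (continuity_2d_pt_filterlim (fun u v => u * sin v)%R s t)).
          apply (continuity_2d_pt_mult (fun u _ => u) (fun _ v => sin v)).
          apply continuity_2d_pt_id1.
          apply (continuity_1d_2d_pt_comp sin (fun _ v => v)).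
          apply continuity_sin. apply continuity_2d_pt_id2. }
        { apply Ccont_mult. apply HT. apply (Hp s t). lra. apply Ccont_id. }
      * apply (continuity_2d_pt_inv (fun u _ => u)). apply continuity_2d_pt_id1. lra.
  - revert HL. apply filter_imp. intros u Hu. apply circ_ex_RInt.
    intros t. eapply Cder_cont. apply HT. now apply Hp.
Qed.

(** * Coefficients of bounded holomorphic functions *)

Lemma Cder_pow n z : Cder (fun w => w ^ S n) z (INR (S n) * z ^ n).
Proof.
  induction n as [|n IH].
  - replace (INR 1 * z ^ 0) with (1 * 1 + z * 0) by (simpl; ring).
    apply (Cder_mult (fun w => w) (fun _ => 1)). apply Cder_id. apply Cder_const.
  - replace (INR (S (S n)) * z ^ S n) with (1 * z ^ S n + z * (INR (S n) * z ^ n)).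
    + apply (Cder_mult (fun w => w) (fun w => w ^ S n)); auto. apply Cder_id.
    + rewrite (S_INR (S n)), RtoC_plus, !Cpow_S. ring.
Qed.

(** A negative power is itself of the form [T' z * z]. *)
Lemma circ_neg_pow s d n : (0 < s)%R ->
  is_RInt (fun t => Re (d / circ s t ^ S n)) 0 (2 * PI) 0%R.
Proof.
  intros Hs.
  assert (H0 : forall t, circ s t <> 0) by (intros t; apply Cmod_gt_0; rewrite Cmod_circ; lra).
  assert (HN : RtoC (INR (S n)) <> 0).
  { intros E. apply RtoC_inj in E. now apply (not_0_INR (S n)). }
  (* [e / z ^ (n + 1)] is the function [T] with [T' z * z = d / z ^ (n + 1)]. *)
  set (e := - d / INR (S n)).
  apply is_RInt_ext with (fun t => Re ((0 * / circ s t ^ S n +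
    e * (- (INR (S n) * circ s t ^ n) * / (circ s t ^ S n * circ s t ^ S n))) * circ s t)).
  { intros t _. f_equal. unfold e. rewrite Cpow_S.
    assert (A := Cpow_nz _ n (H0 t)). assert (B := H0 t). field. auto. }
  apply (circ_der_RInt s (fun z => e * / z ^ S n)
    (fun z => 0 * / z ^ S n + e * (- (INR (S n) * z ^ n) * / (z ^ S n * z ^ S n)))).
  intros t. pose proof (Cpow_nz _ (S n) (H0 t)) as Hp. split.
  - apply (Cder_mult (fun _ => e) (fun z => / z ^ S n)). apply Cder_const.
    replace (- (INR (S n) * circ s t ^ n) * / (circ s t ^ S n * circ s t ^ S n))
      with (- (INR (S n) * circ s t ^ n) / (circ s t ^ S n) ^ 2) by (field; auto).
    apply (Cder_inv_comp (fun z => z ^ S n)); auto. apply Cder_pow.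
  - assert (Cc : forall k, Ccont (fun z => z ^ k) (circ s t)).
    { intros [|k]. apply Ccont_const. eapply Cder_cont. apply Cder_pow. }
    apply Ccont_plus; apply Ccont_mult; try apply Ccont_const.
    + now apply (Ccont_inv (fun z => z ^ S n)).
    + apply Ccont_mult.
      * apply Ccont_opp. apply Ccont_mult; auto. apply Ccont_const.
      * apply (Ccont_inv (fun z => z ^ S n * z ^ S n)). now apply Ccont_mult.
        now apply Cmult_neq_0.
Qed.

(** Mean value property in the form of an inequality: the mean over [|z| = s] equals the
    mean over arbitrarily small circles, where the principal part [d / z ^ (n + 1)]
    averages to 0 and only [c] survives. *)
Lemma mean_le T r s c d n K delta (m : R) :
  hol (punct r) T -> (0 < s < r)%R -> (0 < delta)%R ->
  (forall z, (0 < Cmod z < delta)%R -> (Cmod (T z - c - d / z ^ S n) <= K * Cmod z)%R) ->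
  (forall z, Cmod z = s -> (Re (T z) <= m)%R) ->
  (Re c <= m)%R.
Proof.
  intros HT Hs Hd HK Hm. destruct (Rle_lt_dec (Re c) m) as [|Hlt]; auto. exfalso.
  set (e := ((Re c - m) / (Rabs K + 1))%R).
  pose proof (Rabs_pos K) as HK0.
  assert (He : (0 < e)%R) by (apply Rdiv_lt_0_compat; lra).
  (* A circle so small that the error [K * |z|] is below [Re c - m]. *)
  set (s' := (Rmin (Rmin delta s) e / 2)%R).
  assert (M1 := Rmin_l (Rmin delta s) e). assert (M2 := Rmin_r (Rmin delta s) e).
  assert (M3 := Rmin_l delta s). assert (M4 := Rmin_r delta s).
  assert (M0 : (0 < Rmin (Rmin delta s) e)%R) by (repeat apply Rmin_pos; lra).
  assert (Hs' : (0 < s' < delta)%R /\ (s' < s)%R /\ (s' < e)%R) by (unfold s'; lra).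
  assert (HKs : (K * s' < Re c - m)%R).
  { apply Rle_lt_trans with (Rabs K * s')%R.
    apply Rmult_le_compat_r. lra. apply Rle_abs.
    apply Rle_lt_trans with ((Rabs K + 1) * s')%R. apply Rmult_le_compat_r; lra.
    apply Rlt_le_trans with ((Rabs K + 1) * e)%R. apply Rmult_lt_compat_l; lra.
    right. unfold e. field. lra. }
  assert (HC : forall u, (0 < u < r)%R -> forall t, Ccont T (circ u t)).
  { intros u Hu t. apply (hol_cont _ _ _ HT). unfold punct. rewrite Cmod_circ; lra. }
  pose proof PI_RGT_0 as Hpi.
  assert (Up : (RInt (fun t => Re (T (circ s t))) 0 (2 * PI) <= 2 * PI * m)%R).
  { replace (2 * PI * m)%R with (RInt (fun _ => m) 0 (2 * PI)).
    - apply RInt_le. lra. apply circ_ex_RInt, HC; lra. apply ex_RInt_const.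
      intros t _. apply Hm. apply Cmod_circ. lra.
    - rewrite RInt_const. change ((2 * PI - 0) * m = 2 * PI * m)%R. ring. }
  assert (Lo : (2 * PI * (Re c - K * s') <= RInt (fun t => Re (T (circ s' t))) 0 (2 * PI))%R).
  { assert (I : is_RInt (fun t => (Re c - K * s') + Re (d / circ s' t ^ S n)%C)%R 0 (2 * PI)
       ((2 * PI - 0) * (Re c - K * s') + 0)%R).
    { apply (is_RInt_plus (V := R_NormedModule)
       (fun _ => Re c - K * s')%R (fun t => Re (d / circ s' t ^ S n)%C)).
      apply (is_RInt_const (V := R_NormedModule) 0 (2 * PI) (Re c - K * s')%R).
      apply circ_neg_pow. lra. }
    replace (2 * PI * (Re c - K * s'))%R with
      (RInt (fun t => (Re c - K * s') + Re (d / circ s' t ^ S n)%C)%R 0 (2 * PI)).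
    - apply RInt_le. lra. eexists. apply I. apply circ_ex_RInt, HC; lra.
      intros t _. specialize (HK (circ s' t)). rewrite Cmod_circ in HK by lra.
      specialize (HK ltac:(lra)).
      pose proof (re_le_Cmod (T (circ s' t) - c - d / circ s' t ^ S n)) as HR.
      apply Rabs_le_between in HR. unfold Cminus in HR. rewrite !re_plus, !re_opp in HR.
      unfold Cminus in HK. lra.
    - apply (is_RInt_unique (V := R_CompleteNormedModule)) in I.
      etransitivity; [exact I|]. apply Rminus_diag_uniq. ring. }
  rewrite (circ_const T r s' s HT) in Lo by lra. nra.
Qed.

Lemma quad_expand (P Q F0 : C) : (Cmod F0 <= 1)%R ->
  (Re (F0 * (P * Cconj Q)) <= (Cmod P ^ 2 + Cmod Q ^ 2) / 2)%R.
Proof.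
  intros HF. eapply Rle_trans. apply Rle_abs. eapply Rle_trans. apply re_le_Cmod.
  rewrite !Cmod_mult, Cmod_conj. pose proof (Cmod_ge_0 F0). pose proof (Cmod_ge_0 P).
  pose proof (Cmod_ge_0 Q). assert (0 <= Cmod P * Cmod Q)%R by now apply Rmult_le_pos.
  assert (0 <= (Cmod P - Cmod Q) ^ 2)%R by apply pow2_ge_0. nra.
Qed.

(** With [u = (z / s) ^ (n + 1)], [P = al + be * u] and [Q = ga + de * u], integrate the
    pointwise bound [Re (F * P * conj Q) <= (|P| ^ 2 + |Q| ^ 2) / 2] over [|z| = s].
    There [conj u = 1 / u], which makes [P * conj Q] a Laurent polynomial, so that
    [mean_le] applies.  The cross terms of [|P| ^ 2] and [|Q| ^ 2] are moved into the
    holomorphic function, where they have mean 0. *)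
Lemma coeff_form F r s c0 c n K delta al be ga de :
  hol (punct r) F -> (0 < s < r)%R -> (0 < delta)%R ->
  (forall z, punct r z -> (Cmod (F z) <= 1)%R) ->
  (forall z, (0 < Cmod z < delta)%R ->
     (Cmod (F z - c0 - c * z ^ S n) <= K * Cmod z ^ S (S n))%R) ->
  (Re (c0 * (al * Cconj ga + be * Cconj de) + c * RtoC s ^ S n * (al * Cconj de)) <=
   (Cmod al ^ 2 + Cmod be ^ 2 + Cmod ga ^ 2 + Cmod de ^ 2) / 2)%R.
Proof.
  intros HF Hs Hd Hb HK.
  set (N := S n). set (sN := RtoC s ^ N).
  assert (HsN : sN <> 0) by (apply Cpow_nz; intros E; apply RtoC_inj in E; lra).
  (* [P * conj Q = A + B * z ^ N + D / z ^ N] on [|z| = s]; [E] collects the cross terms. *)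
  set (A := al * Cconj ga + be * Cconj de). set (B := be * Cconj ga / sN).
  set (D := al * Cconj de * sN). set (E := (Cconj al * be + Cconj ga * de) / sN).
  set (T := fun z => F z * (A + B * z ^ N + D / z ^ N) - E * z ^ N).
  set (dl := Rmin delta 1).
  assert (Hdl : (0 < dl)%R) by (apply Rmin_pos; lra).
  pose proof (Rmin_l delta 1) as L1. pose proof (Rmin_r delta 1) as L2. fold dl in L1, L2.
  assert (Hpz : forall z, punct r z -> z ^ N <> 0).
  { intros z [Hz _]. apply Cpow_nz. now apply Cmod_gt_0. }
  fold N. fold sN. replace (c0 * A + c * sN * (al * Cconj de)) with (c0 * A + c * D)
    by (unfold D; ring).
  apply (mean_le T r s (c0 * A + c * D) (c0 * D) n
    (Rabs K * (Cmod A + Cmod B + Cmod D) +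
     Cmod (c * A + c0 * B) + Cmod (c * B) + Cmod E) dl); auto.
  - unfold T. hol_tac. auto.
  - intros z Hz. fold N.
    assert (Hz0 : z ^ N <> 0) by (apply Cpow_nz, Cmod_gt_0; lra).
    specialize (HK z ltac:(lra)). set (R0 := F z - c0 - c * z ^ S n) in *.
    set (x := Cmod z) in *.
    assert (HN : (0 < x ^ N <= x)%R).
    { split. apply pow_lt; lra. unfold N. simpl.
      assert (x ^ n <= 1)%R. { rewrite <- (pow1 n). apply pow_incr. lra. } nra. }
    replace (T z - (c0 * A + c * D) - c0 * D / z ^ N)
      with (R0 * (A + B * z ^ N + D / z ^ N) + (c * A + c0 * B) * z ^ N
            + (c * B) * (z ^ N * z ^ N) + - (E * z ^ N)).
    2:{ unfold T, R0. fold N. field. auto. }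
    assert (HR0 : (Cmod R0 <= Rabs K * (x * x ^ N))%R).
    { eapply Rle_trans. apply HK. change (x ^ S (S n))%R with (x * x ^ N)%R.
      apply Rmult_le_compat_r; [|apply Rle_abs]. nra. }
    assert (T1 : (Cmod (R0 * (A + B * z ^ N + D / z ^ N))
                  <= Rabs K * (Cmod A + Cmod B + Cmod D) * x)%R).
    { replace (R0 * (A + B * z ^ N + D / z ^ N)) with
        (R0 * (A + B * z ^ N) + R0 / z ^ N * D) by (field; auto).
      eapply Rle_trans. apply Cmod_triangle. rewrite (Cmod_mult R0), (Cmod_mult _ D), Cmod_div by auto.
      rewrite Cmod_pow. fold x.
      assert (HAB : (Cmod (A + B * z ^ N) <= Cmod A + Cmod B)%R).
      { eapply Rle_trans. apply Cmod_triangle. rewrite Cmod_mult, Cmod_pow. fold x.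
        pose proof (Cmod_ge_0 B). nra. }
      assert (HR1 : (Cmod R0 <= Rabs K * x)%R).
      { eapply Rle_trans. apply HR0. apply Rmult_le_compat_l. apply Rabs_pos. nra. }
      assert (HR2 : (Cmod R0 / x ^ N <= Rabs K * x)%R).
      { apply Rle_div_l. lra. rewrite Rmult_assoc. exact HR0. }
      pose proof (Cmod_ge_0 D). pose proof (Cmod_ge_0 R0).
      assert (Cmod R0 * Cmod (A + B * z ^ N) <= Rabs K * x * (Cmod A + Cmod B))%R.
      { apply Rmult_le_compat; auto using Cmod_ge_0. }
      assert (Cmod R0 / x ^ N * Cmod D <= Rabs K * x * Cmod D)%R.
      { apply Rmult_le_compat_r; auto. }
      lra. }
    assert (T2 : (Cmod ((c * A + c0 * B) * z ^ N) <= Cmod (c * A + c0 * B) * x)%R).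
    { rewrite Cmod_mult, Cmod_pow. apply Rmult_le_compat_l. apply Cmod_ge_0. apply HN. }
    assert (T3 : (Cmod ((c * B) * (z ^ N * z ^ N)) <= Cmod (c * B) * x)%R).
    { rewrite (Cmod_mult (c * B)), (Cmod_mult (z ^ N)), Cmod_pow. fold x.
      apply Rmult_le_compat_l. apply Cmod_ge_0. nra. }
    assert (T4 : (Cmod (- (E * z ^ N)) <= Cmod E * x)%R).
    { rewrite Cmod_opp, Cmod_mult, Cmod_pow. apply Rmult_le_compat_l. apply Cmod_ge_0. apply HN. }
    eapply Rle_trans. apply Cmod_triangle. eapply Rle_trans. apply Rplus_le_compat_r.
    apply Cmod_triangle. eapply Rle_trans. apply Rplus_le_compat_r, Rplus_le_compat_r.
    apply Cmod_triangle. lra.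
  - intros z Hz.
    assert (Hz0 : z <> 0) by (apply Cmod_gt_0; lra).
    assert (HzN : z ^ N <> 0) by now apply Cpow_nz.
    set (u := z ^ N / sN). assert (Hu : Cconj u = sN / z ^ N).
    { assert (E1 : u * Cconj u = 1).
      { rewrite <- Cmod2_conj. unfold u, sN. rewrite Cmod_div, !Cmod_pow, Cmod_R, Hz, Rabs_pos_eq;
         auto; try lra. unfold Rdiv. rewrite Rinv_r. now rewrite pow1. apply pow_nonzero. lra. }
      replace (Cconj u) with ((u * Cconj u) / u).
      rewrite E1. unfold u. field. auto. field. unfold u.
      unfold Cdiv. apply Cmult_neq_0; auto.
      intros E2. apply C1_nz. rewrite <- (Cinv_r sN HsN), E2. ring. }
    set (P := al + be * u). set (Q := ga + de * u).
    assert (HF1 : (Cmod (F z) <= 1)%R) by (apply Hb; unfold punct; lra).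
    pose proof (quad_expand P Q (F z) HF1) as HQ.
    assert (EPQ : A + B * z ^ N + D / z ^ N = P * Cconj Q).
    { unfold P, Q. rewrite Cplus_conj, Cmult_conj, Hu. unfold A, B, D, u. field. auto. }
    assert (Hu1 : Cmod u = 1%R).
    { unfold u, sN. rewrite Cmod_div, !Cmod_pow, Cmod_R, Hz, Rabs_pos_eq; auto; try lra.
      unfold Rdiv. apply Rinv_r. apply pow_nonzero. lra. }
    assert (Exp : forall x y : C, (Cmod (x + y * u) ^ 2 = Cmod x ^ 2 + Cmod y ^ 2
      + 2 * Re (Cconj x * y * u)%C)%R).
    { intros x y. rewrite !Cmod2_alt.
      assert (HU : (Re u ^ 2 + Im u ^ 2 = 1)%R) by (rewrite <- Cmod2_alt, Hu1; ring).
      rewrite re_plus, im_plus.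
      repeat (rewrite re_mult || rewrite im_mult).
      change (Re (Cconj x)) with (Re x). change (Im (Cconj x)) with (- Im x)%R.
      replace (Re y ^ 2 + Im y ^ 2)%R with ((Re y ^ 2 + Im y ^ 2) * (Re u ^ 2 + Im u ^ 2))%R
        by (rewrite HU; ring). ring. }
    unfold P, Q in HQ. rewrite !Exp in HQ. unfold T. rewrite EPQ.
    unfold Cminus. rewrite re_plus, re_opp.
    replace (E * z ^ N) with (Cconj al * be * u + Cconj ga * de * u)
      by (unfold E, u; field; auto).
    rewrite re_plus. fold P Q in HQ. lra.
Qed.

(** By [coeff_form] the matrix with rows [(c0, 0)] and [(e, c0)], where
    [e = c * s ^ (n + 1)], is a contraction for all [s < r]; testing it on a suitable
    vector gives [|e| <= 1 - |c0| ^ 2]. *)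
Lemma coeff_bound F r c0 c n K delta :
  hol (punct r) F -> (0 < r)%R -> (0 < delta)%R ->
  (forall z, punct r z -> (Cmod (F z) <= 1)%R) ->
  (forall z, (0 < Cmod z < delta)%R ->
     (Cmod (F z - c0 - c * z ^ S n) <= K * Cmod z ^ S (S n))%R) ->
  (Cmod c * r ^ S n <= 1 - Cmod c0 ^ 2)%R.
Proof.
  intros HF Hr Hd Hb HK.
  assert (Main : forall s, (0 < s < r)%R -> (Cmod c * s ^ S n <= 1 - Cmod c0 ^ 2)%R).
  { intros s Hs. set (e := c * RtoC s ^ S n).
    assert (He : Cmod e = (Cmod c * s ^ S n)%R).
    { unfold e. rewrite Cmod_mult, Cmod_pow, Cmod_R, Rabs_pos_eq; lra. }
    (* [(c0, e + c0 * be)] is the image of the vector [(1, be)] under the matrix. *)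
    assert (G : forall be, (Cmod c0 ^ 2 + Cmod (e + c0 * be) ^ 2 <= 1 + Cmod be ^ 2)%R).
    { intros be.
      pose proof (coeff_form F r s c0 c n K delta 1 be c0 (e + c0 * be) HF Hs Hd Hb HK) as H.
      rewrite Cmod_1 in H.
      replace (c0 * (1 * Cconj c0 + be * Cconj (e + c0 * be)) +
        c * RtoC s ^ S n * (1 * Cconj (e + c0 * be)))
        with (c0 * Cconj c0 + (e + c0 * be) * Cconj (e + c0 * be)) in H
        by (unfold e; ring).
      rewrite <- !Cmod2_conj, <- RtoC_plus, re_RtoC in H. lra. }
    rewrite <- He. set (x := Cmod c0) in *. set (y := Cmod e) in *.
    assert (Hx := Cmod_ge_0 c0). assert (Hy := Cmod_ge_0 e). fold x in Hx. fold y in Hy.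
    assert (G0 := G 0). rewrite Cmult_0_r, Cplus_0_r, Cmod_0 in G0. fold y in G0.
    (* The extremal vector has [be = t * conj c0 * e] with [t = 1 / (1 - |c0| ^ 2)]. *)
    assert (Gt : forall t : R, (0 <= t)%R ->
      (x ^ 2 + (y * (1 + t * x ^ 2)) ^ 2 <= 1 + (t * x * y) ^ 2)%R).
    { intros t Ht. specialize (G (RtoC t * Cconj c0 * e)).
      replace (e + c0 * (RtoC t * Cconj c0 * e)) with (e * RtoC (1 + t * x ^ 2)) in G.
      - rewrite !Cmod_mult, !Cmod_R, Cmod_conj in G. fold x y in G.
        rewrite !Rabs_pos_eq in G; auto. nra.
      - rewrite RtoC_plus, RtoC_mult. unfold x. rewrite Cmod2_conj. ring. }
    destruct (Rle_lt_dec (1 - x ^ 2) 0) as [H1|H1].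
    - nra.
    - set (v := (1 - x ^ 2)%R) in *. specialize (Gt (/ v)%R).
      assert (Hv : (0 < / v)%R) by now apply Rinv_0_lt_compat.
      specialize (Gt ltac:(lra)).
      replace (1 + / v * x ^ 2)%R with (/ v)%R in Gt
        by (unfold v in *; field; lra).
      assert (Gv : (y ^ 2 * / v <= v)%R).
      { assert (E : (y ^ 2 * / v = (y * / v) ^ 2 - (/ v * x * y) ^ 2)%R).
        { replace (x)%R with x by auto.
          assert (E' : (x ^ 2 = 1 - v)%R) by (unfold v; ring).
          replace ((/ v * x * y) ^ 2)%R with (/ v * / v * (x ^ 2) * y ^ 2)%R by ring.
          rewrite E'. field. lra. }
        rewrite E. unfold v at 3. lra. }
      assert (Gv' : (y ^ 2 <= v * v)%R).
      { apply Rmult_le_compat_r with (r := v) in Gv; [|lra].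
        rewrite Rmult_assoc, Rinv_l, Rmult_1_r in Gv; lra. }
      nra. }
  destruct (Rle_lt_dec (Cmod c * r ^ S n) (1 - Cmod c0 ^ 2)) as [|Hlt]; auto. exfalso.
  assert (HC : continuity_pt (fun s => Cmod c * s ^ S n)%R r) by reg.
  destruct (HC (Cmod c * r ^ S n - (1 - Cmod c0 ^ 2))%R) as [al [Hal H]]; [lra|].
  set (s := (r - Rmin (al / 2) (r / 2))%R).
  assert (M1 := Rmin_l (al / 2) (r / 2)). assert (M2 := Rmin_r (al / 2) (r / 2)).
  assert (M0 : (0 < Rmin (al / 2) (r / 2))%R) by (apply Rmin_pos; lra).
  specialize (Main s ltac:(unfold s; lra)).
  specialize (H s). simpl in H. unfold R_dist, D_x, no_cond in H.
  assert (Hs : (Rabs (s - r) < al)%R).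
  { unfold s. rewrite Rabs_left; lra. }
  specialize (H ltac:(split; [split; [auto|unfold s; lra]|exact Hs])).
  apply Rabs_def2 in H. simpl in Main. simpl in Hlt. lra.
Qed.

(** * Schwarz lemma, Lipschitz bound and fixed points *)

Lemma disk_0 : unit_disk 0.
Proof. unfold unit_disk. rewrite Cmod_0. lra. Qed.

Lemma Cder_lip F z l : Cder F z l -> exists K delta : R, (0 < delta)%R /\
  forall w, (Cmod (w - z) < delta)%R -> (Cmod (F w - F z) <= K * Cmod (w - z))%R.
Proof.
  intros H. destruct (proj1 (Cder_eps _ _ _) H (mkposreal 1 Rlt_0_1)) as [d Hd].
  exists (1 + Cmod l)%R, d. split. apply cond_pos. intros w Hw.
  specialize (Hd w Hw). simpl in Hd.
  replace (F w - F z) with ((F w - F z - l * (w - z)) + l * (w - z)) by ring.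
  eapply Rle_trans. apply Cmod_triangle. rewrite (Cmod_mult l). lra.
Qed.

Lemma moebius_denom z u : unit_disk z -> unit_disk u ->
  (1 - Cmod z <= Cmod (1 + Cconj z * u))%R /\ 1 + Cconj z * u <> 0.
Proof.
  unfold unit_disk. intros Hz Hu.
  assert (H : (1 - Cmod z <= Cmod (1 + Cconj z * u))%R).
  { pose proof (Cmod_triangle_rev 1 (- (Cconj z * u))) as H.
    replace (1 - - (Cconj z * u)) with (1 + Cconj z * u) in H by ring.
    rewrite Cmod_1, Cmod_opp, Cmod_mult, Cmod_conj in H.
    pose proof (Cmod_ge_0 z). pose proof (Cmod_ge_0 u). nra. }
  split; auto. apply Cmod_gt_0. lra.
Qed.

(** The Moebius map sending 0 to [z] multiplies [1 - |u| ^ 2] by a bounded factor, so it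
    keeps circles close to the unit circle close to it. *)
Lemma moebius_mod z u : unit_disk z -> unit_disk u ->
  ((1 - Cmod ((u + z) / (1 + Cconj z * u)) ^ 2) * Cmod (1 + Cconj z * u) ^ 2
   = (1 - Cmod u ^ 2) * (1 - Cmod z ^ 2))%R.
Proof.
  intros Hz Hu. destruct (moebius_denom z u Hz Hu) as [H1 H2].
  unfold unit_disk in Hz. rewrite Cmod_div by auto. unfold Rdiv.
  replace ((1 - (Cmod (u + z) * / Cmod (1 + Cconj z * u)) ^ 2) * Cmod (1 + Cconj z * u) ^ 2)%R
    with (Cmod (1 + Cconj z * u) ^ 2 - Cmod (u + z) ^ 2)%R by (field; lra).
  rewrite !Cmod2_alt. rewrite !re_plus, !im_plus, re_mult, im_mult.
  change (Re (Cconj z)) with (Re z). change (Im (Cconj z)) with (- Im z)%R.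
  change (Re 1) with 1%R. change (Im 1) with 0%R. ring.
Qed.

(** Schwarz's lemma.  Instead of the maximum principle, the mean value property is applied
    to [om] composed with the Moebius map sending 0 to the given point: on circles of
    radius tending to 1 the hypothesis bounds the composite by a number tending to 1. *)
Lemma schwarz_sq om : hol unit_disk om ->
  (forall z, unit_disk z -> (Cmod (z ^ 2 * om z) <= 1)%R) ->
  forall z, unit_disk z -> (Cmod (om z) <= 1)%R.
Proof.
  intros Hom Hb z0 Hz0. destruct (Rle_lt_dec (Cmod (om z0)) 1) as [|Hy]; auto. exfalso.
  set (y := Cmod (om z0)) in *. set (x := Cmod z0).
  assert (Hx : (0 <= x < 1)%R) by (split; [apply Cmod_ge_0|exact Hz0]).
  set (phi := fun u => (u + z0) / (1 + Cconj z0 * u)).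
  set (M := ((1 + x) / (1 - x))%R).
  assert (HM : (1 <= M)%R) by (apply Rle_div_r; lra).
  assert (Hphi : forall u, unit_disk u -> (1 - Cmod (phi u) ^ 2 <= (1 - Cmod u ^ 2) * M)%R
     /\ unit_disk (phi u)).
  { intros u Hu. pose proof (moebius_mod z0 u Hz0 Hu) as E. fold (phi u) in E. fold x in E.
    destruct (moebius_denom z0 u Hz0 Hu) as [H1 H2]. fold x in H1.
    set (q := Cmod (1 + Cconj z0 * u)) in *.
    assert (P : (0 < 1 - Cmod u ^ 2)%R).
    { unfold unit_disk in Hu. pose proof (Cmod_ge_0 u). nra. }
    assert (P2 : (0 < 1 - x ^ 2)%R) by nra.
    assert (P3 : (0 < q ^ 2)%R) by (apply pow_lt; lra).
    assert (P4 : ((1 - x) ^ 2 <= q ^ 2)%R) by (apply pow_incr; lra).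
    assert (P5 : (0 < (1 - Cmod u ^ 2) * (1 - x ^ 2))%R) by now apply Rmult_lt_0_compat.
    assert (P6 : (0 < 1 - Cmod (phi u) ^ 2)%R) by nra.
    split.
    - unfold M. apply Rmult_le_reg_r with ((1 - x) ^ 2)%R. nra.
      replace ((1 - Cmod u ^ 2) * ((1 + x) / (1 - x)) * (1 - x) ^ 2)%R with
        ((1 - Cmod u ^ 2) * (1 - x ^ 2))%R by (field; lra).
      rewrite <- E. apply Rmult_le_compat_l; lra.
    - unfold unit_disk. pose proof (Cmod_ge_0 (phi u)). nra. }
  assert (Hphol : hol unit_disk phi).
  { unfold phi. hol_tac. intros u Hu. apply moebius_denom; auto. }
  destruct (Cmod_dual (om z0)) as [e [He1 He2]].
  set (T := fun u => e * om (phi u)).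
  assert (HT : hol unit_disk T).
  { unfold T. apply hol_mult. apply hol_const.
    apply (hol_comp unit_disk unit_disk phi om); auto. intros u Hu. now apply Hphi. }
  assert (ET : T 0 = e * om z0).
  { unfold T, phi. do 2 f_equal. field. }
  (* [eta] makes the bound on [|om o phi|] over the circle of radius [s] less than [y]. *)
  set (eta := ((1 - / y) / (2 * M))%R).
  assert (Hiy : (0 < / y < 1)%R).
  { split. apply Rinv_0_lt_compat. lra. rewrite <- Rinv_1. apply Rinv_lt_contravar; lra. }
  assert (Heta : (0 < eta < 1)%R).
  { unfold eta. split. apply Rdiv_lt_0_compat; lra. apply Rlt_div_l; lra. }
  set (s := (1 - eta / 2)%R).
  destruct HT as [T1 HT1]. destruct (Cder_lip T 0 (T1 0)) as [K [d [Hd HK]]].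
  { apply HT1. apply disk_0. }
  assert (Hq : (eta * M = (1 - / y) / 2)%R) by (unfold eta; field; lra).
  set (q := (1 - eta * M)%R). assert (Hq0 : (/ y < q)%R) by (unfold q; lra).
  assert (Hfin : (Re (e * om z0) <= / q)%R).
  { apply (mean_le T 1 s (e * om z0) 0 0 K d).
    - exists T1. intros z [_ Hz]. now apply HT1.
    - unfold s. lra.
    - auto.
    - intros z [_ Hz]. specialize (HK z). rewrite ET in HK.
      replace (z - 0) with z in HK by ring.
      replace (T z - e * om z0 - 0 / z ^ 1) with (T z - e * om z0) by (unfold Cdiv; ring). auto.
    - intros u Hu. eapply Rle_trans. apply Rle_abs. eapply Rle_trans. apply re_le_Cmod.
      unfold T. rewrite Cmod_mult, He1, Rmult_1_l.
      assert (Hud : unit_disk u) by (unfold unit_disk; rewrite Hu; unfold s; lra).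
      destruct (Hphi u Hud) as [A B]. specialize (Hb _ B).
      rewrite Cmod_mult, Cmod_pow in Hb. rewrite Hu in A.
      assert (Hs2 : ((1 - s ^ 2) * M <= eta * M)%R).
      { apply Rmult_le_compat_r. lra. unfold s. nra. }
      assert (Hq1 : (q <= Cmod (phi u) ^ 2)%R) by (unfold q; lra).
      apply Rmult_le_reg_l with q. lra. rewrite Rinv_r by lra.
      eapply Rle_trans; [|apply Hb]. apply Rmult_le_compat_r; auto. apply Cmod_ge_0. }
  rewrite He2 in Hfin. fold y in Hfin.
  assert (/ q < / / y)%R by (apply Rinv_lt_contravar; [apply Rmult_lt_0_compat|]; lra).
  rewrite Rinv_inv in H. lra.
Qed.

Lemma disk_convex z w t : unit_disk z -> unit_disk w -> (0 <= t <= 1)%R ->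
  unit_disk (z + RtoC t * (w - z)).
Proof.
  unfold unit_disk. intros Hz Hw Ht.
  replace (z + RtoC t * (w - z)) with (RtoC (1 - t) * z + RtoC t * w)
    by (rewrite RtoC_minus; ring).
  eapply Rle_lt_trans. apply Cmod_triangle. rewrite !Cmod_mult, !Cmod_R, !Rabs_pos_eq by lra.
  destruct (Req_dec t 0) as [->|]. lra. nra.
Qed.

Lemma disk_lipschitz F F1 :
  (forall z, unit_disk z -> Cder F z (F1 z)) ->
  (forall z, unit_disk z -> (Cmod (F1 z) <= 1)%R) ->
  forall z w, unit_disk z -> unit_disk w -> (Cmod (F w - F z) <= Cmod (w - z))%R.
Proof.
  intros HF HF1 z w Hz Hw. destruct (Cmod_dual (F w - F z)) as [e [He <-]].
  set (x := fun t => (Re z + t * Re (w - z)%C)%R).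
  set (y := fun t => (Im z + t * Im (w - z)%C)%R).
  assert (Hg : forall t, (x t, y t) = z + RtoC t * (w - z)).
  { intros t. unfold x, y. destruct z, w. apply injective_projections; simpl; unfold Re, Im; simpl; ring. }
  assert (HD : forall t, (0 <= t <= 1)%R -> is_derive (fun u => Re (e * F (x u, y u))) t
    (Re (e * F1 (x t, y t) * (w - z)))).
  { intros t Ht. assert (Hd : unit_disk (x t, y t)) by (rewrite Hg; now apply disk_convex).
    replace (w - z) with ((Re (w - z), Im (w - z)) : C) by (symmetry; apply surjective_pairing).
    apply (path_der x y t _ _ (fun u => e * F u)).
    - unfold x. auto_derive; auto. apply Rmult_1_l.
    - unfold y. auto_derive; auto. apply Rmult_1_l.
    - replace (e * F1 (x t, y t)) with (0 * F (x t, y t) + e * F1 (x t, y t)) by ring.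
      apply (Cder_mult (fun _ => e)). apply Cder_const. auto. }
  destruct (MVT_gen (fun u => Re (e * F (x u, y u))) 0 1
    (fun t => Re (e * F1 (x t, y t) * (w - z)))) as [c [Hc E]].
  - intros t. rewrite Rmin_left, Rmax_right by lra. intros Ht. apply HD. lra.
  - intros t. rewrite Rmin_left, Rmax_right by lra. intros Ht.
    apply continuity_pt_filterlim. apply (ex_derive_continuous (fun u => Re (e * F (x u, y u)))).
    eexists. apply HD. lra.
  - rewrite Rmin_left, Rmax_right in Hc by lra. rewrite !Hg in E.
    replace (z + 1 * (w - z)) with w in E by ring.
    replace (z + 0 * (w - z)) with z in E by ring.
    replace (Re (e * (F w - F z))) with (Re (e * F w) - Re (e * F z))%R.
    + rewrite E. rewrite Rminus_0_r, Rmult_1_r. eapply Rle_trans. apply Rle_abs.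
      eapply Rle_trans. apply re_le_Cmod. rewrite !Cmod_mult, He.
      assert (Hd := HF1 _ (disk_convex z w c Hz Hw Hc)).
      pose proof (Cmod_ge_0 (w - z)). nra.
    + unfold Cminus. rewrite Cmult_plus_distr_l, re_plus.
      replace (e * - F z) with (- (e * F z)) by ring. rewrite re_opp. ring.
Qed.

(** Banach's fixed point theorem on a closed disk. *)
Lemma contraction_fixpoint (Phi : C -> C) (x0 : C) (r k : R) :
  (0 <= r)%R -> (0 <= k < 1)%R ->
  (forall x, (Cmod (x - x0) <= r)%R -> (Cmod (Phi x - x0) <= r)%R) ->
  (forall x y, (Cmod (x - x0) <= r)%R -> (Cmod (y - x0) <= r)%R ->
     (Cmod (Phi x - Phi y) <= k * Cmod (x - y))%R) ->
  exists x, (Cmod (x - x0) <= r)%R /\ Phi x = x.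
Proof.
  intros Hr Hk Hmap Hlip.
  set (X := fun n => Nat.iter n Phi x0).
  assert (HX : forall n, (Cmod (X n - x0) <= r)%R).
  { induction n as [|n IH]. simpl. unfold Cminus. rewrite Cplus_opp_r, Cmod_0. auto.
    simpl. now apply Hmap. }
  assert (Hinc : forall n, (Cmod (X (S n) - X n) <= r * k ^ n)%R).
  { induction n as [|n IH]. rewrite Rmult_1_r. apply (HX 1%nat).
    change (Cmod (Phi (X (S n)) - Phi (X n)) <= r * (k * k ^ n))%R.
    eapply Rle_trans. apply Hlip; apply HX. nra. }
  assert (Hsum : ex_series (fun n => r * k ^ n)%R).
  { apply (ex_series_scal (V := R_NormedModule) r). apply ex_series_geom. rewrite Rabs_pos_eq; lra. }
  destruct (ex_series_le (V := C_CompleteNormedModule) (fun n => X (S n) - X n) _ Hinc Hsum)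
    as [l Hl].
  assert (Hlim : forall eps : posreal, exists N, forall n, (N <= n)%nat ->
    (Cmod (X (S n) - (x0 + l)) < eps)%R).
  { intros eps.
    assert (He2 : (0 < eps / sqrt 2)%R).
    { apply Rdiv_lt_0_compat. apply cond_pos. apply Rlt_sqrt2_0. }
    destruct (Hl _ (locally_ball l (mkposreal _ He2))) as [N HN]. exists N. intros n Hn.
    specialize (HN n Hn). apply C_NormedModule_mixin_compat2 in HN. simpl in HN.
    replace (X (S n) - (x0 + l)) with (minus (@sum_n C_AbelianMonoid (fun n => X (S n) - X n) n) l).
    - eapply Rlt_le_trans. exact HN. right. field. apply Rgt_not_eq, Rlt_sqrt2_0.
    - assert (E : @sum_n C_AbelianMonoid (fun n => X (S n) - X n) n = X (S n) - x0).
      { clear. induction n as [|n IH]. now rewrite sum_O.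
        rewrite sum_Sn, IH. change (X (S n) - x0 + (X (S (S n)) - X (S n)) = X (S (S n)) - x0).
        ring. }
      rewrite E. change (X (S n) - x0 + - l = X (S n) - (x0 + l)). ring. }
  exists (x0 + l). set (p := x0 + l) in *.
  assert (Hp : (Cmod (p - x0) <= r)%R).
  { apply Rnot_lt_le. intros Hlt.
    assert (He : (0 < Cmod (p - x0) - r)%R) by lra.
    destruct (Hlim (mkposreal _ He)) as [N HN]. specialize (HN N (le_n N)). simpl pos in HN.
    pose proof (HX (S N)) as HXN.
    pose proof (Cmod_triangle (p - X (S N)) (X (S N) - x0)) as Ht.
    replace (p - X (S N) + (X (S N) - x0)) with (p - x0) in Ht by ring.
    rewrite (Cmod_minus_sym p (X (S N))) in Ht. lra. }
  split; auto.
  apply Ceq_minus, Cmod_eq_0. apply Rle_antisym; [|apply Cmod_ge_0].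
  apply le_epsilon. intros eps He.
  assert (He2 : (0 < eps / 2)%R) by lra.
  destruct (Hlim (mkposreal _ He2)) as [N HN].
  pose proof (HN N (le_n N)) as H1. pose proof (HN (S N) (le_S _ _ (le_n N))) as H2.
  simpl pos in H1, H2.
  pose proof (Hlip p (X (S N)) Hp (HX (S N))) as H3.
  pose proof (Cmod_triangle (Phi p - Phi (X (S N))) (X (S (S N)) - p)) as Ht.
  change (X (S (S N))) with (Phi (X (S N))) in *.
  replace (Phi p - Phi (X (S N)) + (Phi (X (S N)) - p)) with (Phi p - p) in Ht by ring.
  rewrite (Cmod_minus_sym p (X (S N))) in H3. pose proof (Cmod_ge_0 (X (S N) - p)). nra.
Qed.

(** * Values omitted by 1 / z plus a Lipschitz perturbation *)

(** The remainder is kept as a holomorphic factor rather than an [O] estimate, so that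
    products and quotients of expansions are computed by ring identities. *)
Definition taylor2 F (c0 c1 c2 : C) : Prop :=
  exists G, hol unit_disk G /\
    forall z, unit_disk z -> F z = c0 + c1 * z + c2 * z ^ 2 + z ^ 3 * G z.

Lemma taylor2_mult F G c0 c1 c2 d0 d1 d2 :
  taylor2 F c0 c1 c2 -> taylor2 G d0 d1 d2 ->
  taylor2 (fun z => F z * G z) (c0 * d0) (c0 * d1 + c1 * d0) (c0 * d2 + c1 * d1 + c2 * d0).
Proof.
  intros [R [HR EF]] [S [HS EG]].
  exists (fun z => c1 * d2 + c2 * d1 + c2 * d2 * z + R z * (d0 + d1 * z + d2 * z ^ 2)
    + S z * (c0 + c1 * z + c2 * z ^ 2) + z ^ 3 * (R z * S z)).
  split. hol_tac. intros z Hz. rewrite EF, EG by auto. ring.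
Qed.

Lemma taylor2_minus F G c0 c1 c2 d0 d1 d2 :
  taylor2 F c0 c1 c2 -> taylor2 G d0 d1 d2 ->
  taylor2 (fun z => F z - G z) (c0 - d0) (c1 - d1) (c2 - d2).
Proof.
  intros [R [HR EF]] [S [HS EG]]. exists (fun z => R z - S z).
  split. hol_tac. intros z Hz. rewrite EF, EG by auto. ring.
Qed.

Lemma taylor2_const c : taylor2 (fun _ => c) c 0 0.
Proof. exists (fun _ => 0). split. hol_tac. intros z _. ring. Qed.

Lemma taylor2_inv F c1 c2 : hol unit_disk F -> (forall z, unit_disk z -> F z <> 0) ->
  taylor2 F 1 c1 c2 -> taylor2 (fun z => / F z) 1 (- c1) (c1 ^ 2 - c2).
Proof.
  intros HF H0 [R [HR EF]].
  exists (fun z => (2 * c1 * c2 - c1 ^ 3 - R z + z * (c1 * R z - (c1 ^ 2 - c2) * c2)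
     - z ^ 2 * ((c1 ^ 2 - c2) * R z)) / F z).
  split. hol_tac. auto. intros z Hz. pose proof (H0 z Hz) as Hn.
  rewrite (EF z Hz) in Hn |- *. field. exact Hn.
Qed.

Lemma taylor2_CS a : disk_coeffs a -> taylor2 (Cpseries a) (a 0%nat) (a 1%nat) (a 2%nat).
Proof.
  intros Ha. exists (Cpseries (shift_coeffs (shift_coeffs (shift_coeffs a)))). split.
  - apply Cpseries_hol. now do 3 apply disk_coeffs_shift.
  - intros z Hz.
    rewrite (Cpseries_shift a), (Cpseries_shift (shift_coeffs a)), (Cpseries_shift (shift_coeffs (shift_coeffs a)))
      by auto using disk_coeffs_shift.
    unfold shift_coeffs at 1 2 3. simpl. ring.
Qed.

Lemma taylor2_shift F c0 c1 c2 : taylor2 F c0 c1 c2 ->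
  taylor2 (fun z => 1 + z * F z) 1 c0 c1.
Proof.
  intros [R [HR EF]]. exists (fun z => c2 + z * R z). split. hol_tac.
  intros z Hz. rewrite EF by auto. ring.
Qed.

Lemma hol_bounded_near_0 G : hol unit_disk G ->
  exists K delta : R, (0 < delta <= 1)%R /\
    forall z, (Cmod z < delta)%R -> (Cmod (G z) <= K)%R.
Proof.
  intros HG. pose proof (hol_cont _ _ _ HG disk_0) as HC.
  destruct (proj1 (Ccont_eps _ _) HC (mkposreal 1 Rlt_0_1)) as [d Hd].
  exists (Cmod (G 0) + 1)%R, (Rmin d 1). split.
  - split. apply Rmin_pos. apply cond_pos. lra. apply Rmin_r.
  - intros z Hz. specialize (Hd z). replace (z - 0) with z in Hd by ring.
    pose proof (Rmin_l d 1). specialize (Hd ltac:(lra)). simpl in Hd.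
    pose proof (Cmod_triangle_rev (G z) (G 0)). lra.
Qed.

Lemma taylor2_bound_1 F c0 c1 c2 : hol unit_disk F -> taylor2 F c0 c1 c2 ->
  (forall z, unit_disk z -> (Cmod (F z) <= 1)%R) -> (Cmod c1 <= 1 - Cmod c0 ^ 2)%R.
Proof.
  intros HF [G [HG EF]] Hb. destruct (hol_bounded_near_0 G HG) as [K [d [Hd HK]]].
  rewrite <- (Rmult_1_r (Cmod c1)). rewrite <- (pow1 1) at 1.
  apply (coeff_bound F 1 c0 c1 0 (Cmod c2 + K) d); try lra.
  - revert HF. apply hol_sub. intros z [_ Hz]. exact Hz.
  - intros z [_ Hz]. now apply Hb.
  - intros z Hz. specialize (HK z ltac:(lra)). rewrite EF by (unfold unit_disk; lra).
    replace (c0 + c1 * z + c2 * z ^ 2 + z ^ 3 * G z - c0 - c1 * z ^ 1)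
      with ((c2 + z * G z) * z ^ 2) by ring.
    rewrite Cmod_mult, Cmod_pow. apply Rmult_le_compat_r. apply pow_le; lra.
    eapply Rle_trans. apply Cmod_triangle. rewrite Cmod_mult.
    pose proof (Cmod_ge_0 (G z)). nra.
Qed.

(** [coeff_bound] has no room for a linear term, which the even part of [F] removes
    without changing [c0], [c2] or the bound on [F]. *)
Lemma taylor2_bound_2 F c0 c1 c2 : hol unit_disk F -> taylor2 F c0 c1 c2 ->
  (forall z, unit_disk z -> (Cmod (F z) <= 1)%R) -> (Cmod c2 <= 1 - Cmod c0 ^ 2)%R.
Proof.
  intros HF [G [HG EF]] Hb. destruct (hol_bounded_near_0 G HG) as [K [d [Hd HK]]].
  rewrite <- (Rmult_1_r (Cmod c2)). rewrite <- (pow1 2) at 1.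
  assert (Hneg : forall z, unit_disk z -> unit_disk (- z)).
  { intros z. unfold unit_disk. now rewrite Cmod_opp. }
  assert (HF' : hol unit_disk (fun z => F (- z))).
  { apply (hol_comp unit_disk unit_disk (fun z => - z) F); auto. hol_tac. }
  apply (coeff_bound (fun z => (F z + F (- z)) / 2) 1 c0 c2 1 K d); try lra.
  - apply hol_sub with unit_disk. intros z [_ Hz]. exact Hz.
    apply (hol_div _ (fun z => F z + F (- z)) (fun _ => 2)).
    now apply (hol_plus _ F (fun z => F (- z))). apply hol_const.
    intros z _ E. apply RtoC_inj in E. lra.
  - intros z [_ Hz].
    assert (E2 : RtoC 2 <> 0) by (intros E; apply RtoC_inj in E; lra).
    rewrite Cmod_div, Cmod_R, Rabs_pos_eq by (auto; lra).
    apply Rle_div_l. lra. eapply Rle_trans. apply Cmod_triangle.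
    pose proof (Hb z Hz). pose proof (Hb (- z) (Hneg z Hz)). lra.
  - intros z Hz. assert (Hz1 : unit_disk z) by (unfold unit_disk; lra).
    pose proof (HK z ltac:(lra)) as K1. pose proof (HK (- z)) as K2.
    rewrite Cmod_opp in K2. specialize (K2 ltac:(lra)).
    rewrite !EF by auto.
    assert (E2 : RtoC 2 <> 0) by (intros E; apply RtoC_inj in E; lra).
    replace ((c0 + c1 * z + c2 * z ^ 2 + z ^ 3 * G z +
      (c0 + c1 * - z + c2 * (- z) ^ 2 + (- z) ^ 3 * G (- z))) / 2 - c0 - c2 * z ^ 2)
      with ((G z - G (- z)) / 2 * z ^ 3) by (field; auto).
    rewrite Cmod_mult, Cmod_pow. apply Rmult_le_compat_r. apply pow_le; lra.
    rewrite Cmod_div, Cmod_R, Rabs_pos_eq by (auto; lra).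
    apply Rle_div_l. lra. eapply Rle_trans. apply Cmod_triangle_minus. lra.
Qed.

Definition lip1 (psi : C -> C) : Prop :=
  forall z w, unit_disk z -> unit_disk w -> (Cmod (psi w - psi z) <= Cmod (w - z))%R.

(** The radius [r] is recorded because the step of [covered_step] depends on it; [r = 1]
    stands for the whole open disk. *)
Definition covered (psi : C -> C) (r : R) (w : C) : Prop :=
  exists ze : C, (0 < Cmod ze <= r)%R /\ (Cmod ze < 1)%R /\ / ze + psi ze = w.

(** [1 / z + psi z = w] means that [z] is a fixed point of [1 / (w - psi z)], a map which is
    contracting where [|w - psi z| >= q > 1]. *)
Lemma covered_by_fixpoint psi x0 r q w : lip1 psi -> (0 <= r)%R -> (1 < q)%R ->
  (forall x, (Cmod (x - x0) <= r)%R -> unit_disk x /\ (q <= Cmod (w - psi x))%R /\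
     (Cmod (/ (w - psi x) - x0) <= r)%R) ->
  covered psi 1 w.
Proof.
  intros Hl Hr Hq H.
  assert (Hiq : (0 < / q < 1)%R).
  { split. apply Rinv_0_lt_compat. lra. rewrite <- Rinv_1. apply Rinv_lt_contravar; lra. }
  assert (Hn : forall x, (Cmod (x - x0) <= r)%R -> w - psi x <> 0).
  { intros x Hx. apply Cmod_gt_0. destruct (H x Hx) as [_ [? _]]. lra. }
  assert (Hinv : forall x, (Cmod (x - x0) <= r)%R -> (Cmod (/ (w - psi x)) <= / q)%R).
  { intros x Hx. rewrite Cmod_inv by auto. apply Rinv_le_contravar. lra. apply H. auto. }
  destruct (contraction_fixpoint (fun x => / (w - psi x)) x0 r (/ q) Hr) as [x [Hx Ex]].
  - lra.
  - intros x Hx. apply H. auto.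
  - intros x y Hx Hy.
    replace (/ (w - psi x) - / (w - psi y)) with
      ((/ (w - psi x)) * (/ (w - psi y)) * (psi x - psi y)) by (field; auto).
    rewrite !Cmod_mult. pose proof (Hinv x Hx) as Ix. pose proof (Hinv y Hy) as Iy.
    destruct (H x Hx) as [Dx _], (H y Hy) as [Dy _]. pose proof (Hl y x Dy Dx) as L.
    assert (P : (Cmod (/ (w - psi x)) * Cmod (/ (w - psi y)) <= / q * 1)%R).
    { apply Rmult_le_compat; auto using Cmod_ge_0. lra. }
    rewrite Rmult_1_r in P. apply Rmult_le_compat; auto using Cmod_ge_0.
    apply Rmult_le_pos; apply Cmod_ge_0.
  - exists x. destruct (H x Hx) as [Dx _]. unfold unit_disk in Dx.
    assert (Hx0 : x <> 0).
    { intros E. apply C1_nz. rewrite <- (Cinv_l _ (Hn x Hx)), Ex, E. ring. }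
    repeat split; try lra. now apply Cmod_gt_0.
    rewrite <- Ex at 1. replace (/ / (w - psi x)) with (w - psi x) by (field; auto). ring.
Qed.

Lemma covered_far psi w : lip1 psi -> psi 0 = 0 -> (2 < Cmod w)%R -> covered psi 1 w.
Proof.
  intros Hl H0 Hw.
  (* The disk of radius [1 - mu / 2] is mapped into itself since
     [(1 - mu / 2) * (1 + 3 / 2 * mu) >= 1]. *)
  set (mu := Rmin (Cmod w - 2) 1).
  assert (M0 : (0 < mu)%R) by (apply Rmin_pos; lra).
  assert (M1 := Rmin_l (Cmod w - 2) 1). assert (M2 := Rmin_r (Cmod w - 2) 1).
  fold mu in M1, M2.
  apply (covered_by_fixpoint psi 0 (1 - mu / 2) (1 + 3 / 2 * mu)); auto; try lra.
  intros x Hx. assert (Dx : unit_disk x).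
  { unfold unit_disk. replace (x - 0) with x in Hx by ring. lra. }
  split; auto.
  assert (B : (1 + 3 / 2 * mu <= Cmod (w - psi x))%R).
  { pose proof (Hl 0 x disk_0 Dx) as L. rewrite H0 in L.
    replace (psi x - 0) with (psi x) in L by ring.
    pose proof (Cmod_triangle_rev w (psi x)). lra. }
  split; auto.
  replace (/ (w - psi x) - 0) with (/ (w - psi x)) by ring.
  rewrite Cmod_inv by (apply Cmod_gt_0; lra).
  apply Rle_trans with (/ (1 + 3 / 2 * mu))%R.
  - apply Rinv_le_contravar; lra.
  - apply Rmult_le_reg_l with (1 + 3 / 2 * mu)%R. lra. rewrite Rinv_r by lra. nra.
Qed.

(** A solution at distance at least [1 - r] from the unit circle moves by at most
    [(1 - r) / 2] when [w] does by at most [(1 - r) ^ 2 / 4]; what matters is that this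
    step depends on [r] only. *)
Lemma covered_step psi r w w' : lip1 psi -> (0 < r < 1)%R ->
  covered psi r w -> (Cmod (w' - w) <= (1 - r) ^ 2 / 4)%R -> covered psi 1 w'.
Proof.
  intros Hl Hr [ze [[Hz0 Hzr] [Hz1 E]]] Hw. set (h := (1 - r)%R) in *.
  assert (Hh : (0 < h < 1)%R) by (unfold h; lra).
  assert (Hzn : ze <> 0) by now apply Cmod_gt_0.
  apply (covered_by_fixpoint psi ze (h / 2) (1 + h / 4)); auto; try lra.
  intros x Hx.
  assert (Dx : unit_disk x).
  { unfold unit_disk. pose proof (Cmod_triangle_rev x ze). unfold h in *. lra. }
  assert (L : (Cmod (psi x - psi ze) <= h / 2)%R).
  { eapply Rle_trans; [apply Hl|]; auto. }
  set (D := w' - psi x).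
  assert (ED : (Cmod (/ ze - D) <= h / 2 + h ^ 2 / 4)%R).
  { replace (/ ze - D) with ((psi x - psi ze) - (w' - w)) by (unfold D; rewrite <- E; ring).
    eapply Rle_trans. apply Cmod_triangle_minus. lra. }
  assert (Hiz : (1 + h <= Cmod (/ ze))%R).
  { rewrite Cmod_inv by auto. apply Rmult_le_reg_l with (Cmod ze); auto.
    rewrite Rinv_r by lra. apply Rle_trans with (r * (1 + h))%R.
    apply Rmult_le_compat_r; lra. unfold h. nra. }
  assert (HD : (1 + h / 4 <= Cmod D)%R).
  { pose proof (Cmod_triangle_rev (/ ze) (/ ze - D)) as T.
    replace (/ ze - (/ ze - D)) with D in T by ring. nra. }
  split; [auto|split; auto].
  assert (HD0 : D <> 0) by (apply Cmod_gt_0; lra).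
  replace (/ D - ze) with (ze * (/ ze - D) / D) by (field; auto).
  rewrite Cmod_div, Cmod_mult by auto. apply Rle_div_l. lra.
  apply Rle_trans with (r * (h / 2 + h ^ 2 / 4))%R.
  - apply Rmult_le_compat; auto using Cmod_ge_0.
  - apply Rle_trans with (h / 2 * 1)%R; [|apply Rmult_le_compat_l; lra].
    replace r with (1 - h)%R by (unfold h; ring). nra.
Qed.

(** [coeff_bound] on [|z| < |ze|] for the difference quotient of [psi] at [ze], whose first two
    coefficients are [t0 = psi ze / ze] and [(t0 - b) / ze], gives
    [|t0 - b| <= 1 - |t0| ^ 2]; the quantity to bound is
    [1 / ze ^ 2 + t0 + (t0 - b) + ze ^ 2 * t0 ^ 2]. *)
Lemma covered_quadratic_bound psi ze b e : hol unit_disk psi -> lip1 psi ->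
  taylor2 psi 0 b e -> (0 < Cmod ze < 1)%R ->
  (Cmod ((/ ze + psi ze) ^ 2 - b) <= 2 + / Cmod ze ^ 2)%R.
Proof.
  intros Hh Hl [G [HG ET]] Hz. assert (Hzn : ze <> 0) by (apply Cmod_gt_0; lra).
  set (r := Cmod ze) in *. set (t0 := psi ze / ze). set (t1 := (t0 - b) / ze).
  destruct (hol_bounded_near_0 G HG) as [K [d [Hd HK]]].
  assert (Hne : forall z, (Cmod z < r)%R -> z - ze <> 0).
  { intros z Hzr E. replace z with ze in Hzr. unfold r in Hzr. lra.
    replace z with ((z - ze) + ze) by ring. rewrite E. ring. }
  assert (Hr2 : (0 < Rmin d (r / 2))%R) by (apply Rmin_pos; lra).
  assert (B : (Cmod t1 * r ^ 1 <= 1 - Cmod t0 ^ 2)%R).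
  { apply (coeff_bound (fun z => (psi z - psi ze) / (z - ze)) r t0 t1 0
      ((Cmod e + K + Cmod t1) / (r / 2)) (Rmin d (r / 2))); try lra.
    - apply (hol_div _ (fun z => psi z - psi ze) (fun z => z - ze)).
      + apply (hol_minus _ psi (fun _ => psi ze)).
        apply hol_sub with unit_disk; auto. intros z Hp. unfold punct, unit_disk in *. lra.
        apply hol_const.
      + hol_tac.
      + intros z [_ Hp]. auto.
    - intros z [_ Hp]. rewrite Cmod_div by auto. apply Rle_div_l.
      apply Cmod_gt_0; auto. rewrite Rmult_1_l. apply Hl; unfold unit_disk; fold r; lra.
    - intros z Hzd. pose proof (Rmin_l d (r / 2)). pose proof (Rmin_r d (r / 2)).
      assert (Hzr : (Cmod z < r)%R) by lra. pose proof (Hne z Hzr) as Hn.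
      rewrite (ET z) by (unfold unit_disk; lra).
      replace ((0 + b * z + e * z ^ 2 + z ^ 3 * G z - psi ze) / (z - ze) - t0 - t1 * z ^ 1)
        with ((e + z * G z - t1) / (z - ze) * z ^ 2)
        by (replace (psi ze) with (t0 * ze) by (unfold t0; field; auto);
            unfold t1; field; auto).
      rewrite Cmod_mult, Cmod_pow. apply Rmult_le_compat_r. apply pow_le; lra.
      rewrite Cmod_div by auto.
      assert (Hlow : (r / 2 <= Cmod (z - ze))%R).
      { rewrite Cmod_minus_sym. pose proof (Cmod_triangle_rev ze z). fold r in H1. lra. }
      unfold Rdiv. apply Rmult_le_compat.
      + apply Cmod_ge_0.
      + left. apply Rinv_0_lt_compat. lra.
      + eapply Rle_trans. apply Cmod_triangle_minus. apply Rplus_le_compat_r.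
        eapply Rle_trans. apply Cmod_triangle. apply Rplus_le_compat_l.
        rewrite Cmod_mult. specialize (HK z ltac:(lra)). pose proof (Cmod_ge_0 (G z)). nra.
      + apply Rinv_le_contravar; lra. }
  assert (B' : (Cmod (t0 - b) <= 1 - Cmod t0 ^ 2)%R).
  { replace (t0 - b) with (t1 * ze) by (unfold t1; field; auto).
    rewrite Cmod_mult. fold r. now rewrite pow_1 in B. }
  replace ((/ ze + psi ze) ^ 2 - b) with (/ ze ^ 2 + t0 + (t0 - b) + ze ^ 2 * t0 ^ 2)
    by (unfold t0; field; auto).
  assert (T1 := Cmod_triangle (/ ze ^ 2 + t0 + (t0 - b)) (ze ^ 2 * t0 ^ 2)).
  assert (T2 := Cmod_triangle (/ ze ^ 2 + t0) (t0 - b)).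
  assert (T3 := Cmod_triangle (/ ze ^ 2) t0).
  rewrite Cmod_mult, !Cmod_pow in T1. rewrite Cmod_inv, Cmod_pow in T3 by now apply Cpow_nz.
  fold r in T1, T3. set (t := Cmod t0) in *.
  assert (Ht : (0 <= t)%R) by apply Cmod_ge_0. pose proof (Cmod_ge_0 (t0 - b)).
  assert (r ^ 2 <= 1)%R by nra. assert (t <= 1)%R by nra. nra.
Qed.

(** Expanding around [a], it is enough that the linear and quadratic terms in [s] have
    nonnegative scalar product with [c = a ^ 2 - b]; the quadratic one is handled by
    choosing [v] among 1 and [i], the linear one by the sign of [v]. *)
Lemma outward_direction (a b : C) : exists v : C, Cmod v = 1%R /\
  forall s : R, (0 <= s)%R -> (Cmod (a ^ 2 - b) <= Cmod ((a + RtoC s * v) ^ 2 - b))%R.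
Proof.
  set (c := a ^ 2 - b).
  assert (Hv : exists v : C, Cmod v = 1%R /\ (0 <= Re (Cconj c * (a * v)))%R /\
    (0 <= Re (Cconj c * (v * v)))%R).
  {
    (* First the quadratic term: replacing [v = 1] by [v = i] changes its sign. *)
    assert (Hv0 : exists v : C, Cmod v = 1%R /\ (0 <= Re (Cconj c * (v * v)))%R).
    { destruct (Rle_lt_dec 0 (Re (Cconj c))) as [H|H].
      - exists 1. split. apply Cmod_1. now rewrite !Cmult_1_r.
      - exists Ci. split. apply Cmod_Ci.
        replace (Ci * Ci) with (RtoC (-1)) by (apply injective_projections; simpl; ring).
        rewrite re_scal_r. lra. }
    destruct Hv0 as [v [H1 H2]]. destruct (Rle_lt_dec 0 (Re (Cconj c * (a * v)))) as [H|H].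
    - now exists v.
    - exists (- v). rewrite Cmod_opp. split; auto. split.
      + replace (Cconj c * (a * - v)) with (- (Cconj c * (a * v))) by ring. rewrite re_opp. lra.
      + now replace (- v * - v) with (v * v) by ring. }
  destruct Hv as [v [H1 [H2 H3]]]. exists v. split; auto. intros s Hs.
  set (u := (a + RtoC s * v) ^ 2 - b).
  assert (E : (Cmod c ^ 2 <= Re (Cconj c * u))%R).
  { replace (Cconj c * u) with (c * Cconj c + (RtoC (2 * s) * (Cconj c * (a * v))
      + RtoC (s * s) * (Cconj c * (v * v))))
      by (unfold u, c; rewrite !RtoC_mult; ring).
    rewrite !re_plus, !re_scal_l, <- Cmod2_conj, re_RtoC. nra. }
  assert (E2 : (Re (Cconj c * u) <= Cmod c * Cmod u)%R).
  { eapply Rle_trans. apply Rle_abs. eapply Rle_trans. apply re_le_Cmod.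
    rewrite Cmod_mult, Cmod_conj. lra. }
  pose proof (Cmod_ge_0 c). pose proof (Cmod_ge_0 u).
  destruct (Req_dec (Cmod c) 0) as [E0|E0]. lra. nra.
Qed.

(** Let [M = |a ^ 2 - b|].  If [M > 3], then by [covered_quadratic_bound] every covered point of
    the half-line of [outward_direction] is covered from [|z| <= r] with
    [r ^ 2 = 1 / (M - 2) < 1], so that [covered_step] walks with a constant step from far
    away, where all is covered, down to [a]. *)
Lemma omitted_bound psi a b e : hol unit_disk psi -> lip1 psi -> taylor2 psi 0 b e ->
  ~ covered psi 1 a -> (Cmod a <= 2)%R /\ (Cmod (a ^ 2 - b) <= 3)%R.
Proof.
  intros Hh Hl HT Ha.
  assert (H0 : psi 0 = 0).
  { destruct HT as [G [_ E]]. rewrite E by apply disk_0. ring. }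
  split.
  { apply Rnot_lt_le. intros H. apply Ha. now apply covered_far. }
  apply Rnot_lt_le. intros H. apply Ha.
  set (M := Cmod (a ^ 2 - b)) in *.
  destruct (outward_direction a b) as [v [Hv Hout]]. fold M in Hout.
  set (r := sqrt (/ (M - 2))).
  assert (Hi : (0 < / (M - 2) < 1)%R).
  { split. apply Rinv_0_lt_compat. lra. rewrite <- Rinv_1. apply Rinv_lt_contravar; lra. }
  assert (Hr : (0 < r < 1)%R).
  { split. apply sqrt_lt_R0. lra. rewrite <- sqrt_1. apply sqrt_lt_1; lra. }
  assert (Hin : forall s, (0 <= s)%R -> covered psi 1 (a + RtoC s * v) ->
    covered psi r (a + RtoC s * v)).
  { intros s Hs [ze [[Hz0 _] [Hz1 E]]]. exists ze. repeat split; auto.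
    pose proof (covered_quadratic_bound psi ze b e Hh Hl HT (conj Hz0 Hz1)) as Q.
    rewrite E in Q. specialize (Hout s Hs).
    assert (Q2 : (M - 2 <= / Cmod ze ^ 2)%R) by lra.
    apply Rinv_le_contravar in Q2; [|lra]. rewrite Rinv_inv in Q2.
    rewrite <- (sqrt_pow2 (Cmod ze)) by lra. now apply sqrt_le_1_alt. }
  set (h := ((1 - r) ^ 2 / 4)%R). assert (Hh0 : (0 < h)%R) by (unfold h; nra).
  destruct (nfloor_ex ((Cmod a + 3) / h)) as [N [_ HN]].
  { pose proof (Cmod_ge_0 a). apply Rle_div_r; lra. }
  assert (Main : forall k, (k <= S N)%nat -> covered psi 1 (a + RtoC (INR (S N - k) * h) * v)).
  { induction k as [|k IH]; intros Hk.
    - apply covered_far; auto. rewrite Nat.sub_0_r.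
      pose proof (Cmod_triangle_rev (RtoC (INR (S N) * h) * v) (- a)) as T.
      replace (RtoC (INR (S N) * h) * v - - a) with (a + RtoC (INR (S N) * h) * v) in T by ring.
      rewrite Cmod_mult, Cmod_R, Hv, Cmod_opp, Rabs_pos_eq in T
        by (apply Rmult_le_pos; [apply pos_INR|lra]).
      assert (HN' : (Cmod a + 3 < INR (S N) * h)%R) by (rewrite S_INR; apply Rlt_div_l; lra).
      lra.
    - specialize (IH ltac:(lia)). apply Hin in IH.
      2:{ apply Rmult_le_pos; [apply pos_INR|lra]. }
      apply (covered_step psi r _ _ Hl Hr IH).
      replace (S N - k)%nat with (S (S N - S k)) by lia. rewrite S_INR.
      replace (a + RtoC (INR (S N - S k) * h) * v - (a + RtoC ((INR (S N - S k) + 1) * h) * v))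
        with (RtoC (- h) * v) by (rewrite RtoC_opp, !RtoC_mult, RtoC_plus; ring).
      rewrite Cmod_mult, Hv, Cmod_R, Rabs_left by lra. unfold h. lra. }
  specialize (Main (S N) (le_n _)). rewrite Nat.sub_diag in Main. simpl in Main.
  replace (a + RtoC (0 * h) * v) with a in Main by (rewrite Rmult_0_l; ring). exact Main.
Qed.

(** * Coefficients of functions of the class *)

Lemma has_expansion_disk_coeffs f a : has_expansion f a -> disk_coeffs a.
Proof.
  intros [_ [_ H]]. apply disk_coeffs_conv. intros x Hx. exists (f x).
  apply is_pseries_Cser. apply H. unfold unit_disk. rewrite Cmod_R, Rabs_pos_eq; lra.
Qed.

Lemma has_expansion_CS f a z : has_expansion f a -> unit_disk z -> f z = Cpseries a z.
Proof.
  intros [_ [_ H]] Hz. symmetry. apply Cpseries_unique. apply is_pseries_Cser. auto.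
Qed.

(** [(z / f) ^ 2 * f' - 1 = - z ^ 2 * (q ^ 2 - q') / p ^ 2] by direct computation. *)
Lemma class_U_normal_form f a : class_U f -> has_expansion f a ->
  let q := Cpseries (shift_coeffs (shift_coeffs a)) in
  let q1 := Cpseries (deriv_coeffs (shift_coeffs (shift_coeffs a))) in
  forall z, unit_disk z -> 1 + z * q z <> 0 /\
    (Cmod (z ^ 2 * ((q z ^ 2 - q1 z) / (1 + z * q z) ^ 2)) <= 1)%R.
Proof.
  intros [_ [Hnz HU]] Ha q q1.
  pose proof (has_expansion_disk_coeffs f a Ha) as Hd.
  assert (Hd2 : disk_coeffs (shift_coeffs (shift_coeffs a))) by auto using disk_coeffs_shift.
  assert (Ef : forall z, unit_disk z -> f z = z * (1 + z * q z)).
  { intros z Hz. rewrite (has_expansion_CS f a z Ha Hz).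
    rewrite (Cpseries_shift a), (Cpseries_shift (shift_coeffs a)) by auto using disk_coeffs_shift.
    destruct Ha as [A0 [A1 _]]. unfold shift_coeffs at 1. rewrite A0, A1. fold q. ring. }
  assert (Hp : forall z, unit_disk z -> 1 + z * q z <> 0).
  { intros z Hz. destruct (Ceq_dec z 0) as [->|Hz0].
    - replace (1 + 0 * q 0) with (RtoC 1) by ring. apply C1_nz.
    - intros E. apply (Hnz z Hz Hz0). rewrite Ef, E by auto. ring. }
  intros z Hz. split; auto.
  destruct (Ceq_dec z 0) as [->|Hz0].
  { replace (0 ^ 2 * ((q 0 ^ 2 - q1 0) / (1 + 0 * q 0) ^ 2)) with (RtoC 0).
    rewrite Cmod_0. lra. field. }
  assert (HD : C_derive f z = 1 + 2 * (z * q z) + z ^ 2 * q1 z).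
  { apply Cder_unique. pose proof Hz as Hz'. unfold unit_disk in Hz'.
    assert (Hr : (0 < 1 - Cmod z)%R) by lra.
    apply Cder_ext_loc with (fun z => z * (1 + z * q z)) (mkposreal _ Hr).
    - intros w Hw. symmetry. apply Ef. simpl in Hw.
      pose proof (Cmod_triangle_rev w z). unfold unit_disk. lra.
    - replace (1 + 2 * (z * q z) + z ^ 2 * q1 z)
        with (1 * (1 + z * q z) + z * (0 + (1 * q z + z * q1 z))) by ring.
      apply (Cder_mult (fun z => z) (fun z => 1 + z * q z)). apply Cder_id.
      apply (Cder_plus (fun _ => 1) (fun z => z * q z)). apply Cder_const.
      apply (Cder_mult (fun z => z) q). apply Cder_id. now apply Cpseries_der. }
  specialize (HU z Hz). rewrite HD in HU. unfold z_over in HU.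
  destruct (Ceq_dec z 0) as [|_]; [contradiction|]. rewrite Ef in HU by auto.
  pose proof (Hp z Hz) as Hn. left. rewrite <- Cmod_opp. eapply Rle_lt_trans; [|exact HU].
  right. f_equal. field. auto.
Qed.

Lemma class_U_coefficients f a : class_U f -> has_expansion f a ->
  let c0 := a 2%nat ^ 2 - a 3%nat in
  let c1 := 4 * a 2%nat * a 3%nat - 2 * a 4%nat - 2 * a 2%nat ^ 3 in
  let c2 := 3 * a 2%nat ^ 4 - 9 * a 2%nat ^ 2 * a 3%nat + 3 * a 3%nat ^ 2
            + 6 * a 2%nat * a 4%nat - 3 * a 5%nat in
  (Cmod c1 <= 1 - Cmod c0 ^ 2)%R /\ (Cmod c2 <= 1 - Cmod c0 ^ 2)%R /\
  (Cmod (a 2%nat) <= 2)%R /\ (Cmod (a 3%nat) <= 3)%R.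
Proof.
  intros HU Ha c0 c1 c2.
  pose proof (class_U_normal_form f a HU Ha) as NF. cbv zeta in NF.
  set (b := shift_coeffs (shift_coeffs a)) in *.
  set (q := Cpseries b) in *. set (q1 := Cpseries (deriv_coeffs b)) in *.
  assert (Hd : disk_coeffs b).
  { pose proof (has_expansion_disk_coeffs f a Ha). unfold b. auto using disk_coeffs_shift. }
  set (p := fun z => 1 + z * q z).
  set (om := fun z => (q z ^ 2 - q1 z) / p z ^ 2).
  assert (Hp : forall z, unit_disk z -> p z <> 0) by (intros z Hz; now apply NF).
  assert (Hq : hol unit_disk q) by now apply Cpseries_hol.
  assert (Hq1 : hol unit_disk q1) by now apply Cpseries_hol, disk_coeffs_deriv.
  assert (Hph : hol unit_disk p) by (unfold p; hol_tac).
  assert (Homh : hol unit_disk om).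
  { unfold om. apply (hol_div _ (fun z => q z ^ 2 - q1 z) (fun z => p z ^ 2)).
    hol_tac. now apply hol_pow. intros z Hz. apply Cpow_nz. auto. }
  assert (Hom : forall z, unit_disk z -> (Cmod (om z) <= 1)%R).
  { apply schwarz_sq; auto. intros z Hz. now apply NF. }
  pose proof (taylor2_CS b Hd) as Tq. fold q in Tq.
  pose proof (taylor2_CS (deriv_coeffs b) (disk_coeffs_deriv b Hd)) as Tq1. fold q1 in Tq1.
  pose proof (taylor2_inv p _ _ Hph Hp (taylor2_shift _ _ _ _ Tq)) as Tip.
  assert (Tom : taylor2 om c0 c1 c2).
  { pose proof (taylor2_mult _ _ _ _ _ _ _ _ (taylor2_minus _ _ _ _ _ _ _ _
      (taylor2_mult _ _ _ _ _ _ _ _ Tq Tq) Tq1) (taylor2_mult _ _ _ _ _ _ _ _ Tip Tip))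
      as [G [HG E]].
    exists G. split; auto. intros z Hz. pose proof (Hp z Hz) as Hn.
    replace (om z) with ((q z * q z - q1 z) * (/ p z * / p z)) by (unfold om; field; auto).
    rewrite (E z Hz). unfold c0, c1, c2, b, deriv_coeffs, shift_coeffs. simpl INR.
    rewrite !RtoC_plus. ring. }
  set (psi := fun z => a 2%nat - q z / p z).
  assert (Hpsid : forall z, unit_disk z -> Cder psi z (om z)).
  { intros z Hz. pose proof (Hp z Hz) as Hn.
    assert (Dq : Cder q z (q1 z)) by now apply Cpseries_der.
    assert (Dp : Cder p z (0 + (1 * q z + z * q1 z))).
    { apply (Cder_plus (fun _ => 1) (fun z => z * q z)). apply Cder_const.
      apply (Cder_mult (fun z => z) q); auto. apply Cder_id. }
    replace (om z) with (0 - (q1 z * / p z + q z * (- (0 + (1 * q z + z * q1 z)) / p z ^ 2))).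
    - apply (Cder_minus (fun _ => a 2%nat) (fun z => q z / p z)). apply Cder_const.
      apply (Cder_mult q (fun z => / p z)); auto. now apply Cder_inv_comp.
    - unfold om. unfold p in *. field. auto. }
  assert (Hpsi : hol unit_disk psi).
  { exists om. intros z Hz. split; auto. now apply (hol_cont unit_disk). }
  assert (Hlip : lip1 psi) by (intros z w; now apply (disk_lipschitz psi om)).
  assert (Tpsi : exists e, taylor2 psi 0 c0 e).
  { pose proof (taylor2_minus _ _ _ _ _ _ _ _ (taylor2_const (a 2%nat))
      (taylor2_mult _ _ _ _ _ _ _ _ Tq Tip)) as [G [HG E]].
    exists (0 - (b 0%nat * (b 0%nat ^ 2 - b 1%nat) + b 1%nat * - b 0%nat + b 2%nat * 1)).
    exists G. split; auto. intros z Hz. unfold psi, Cdiv. rewrite (E z Hz).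
    unfold c0, b, shift_coeffs. ring. }
  destruct Tpsi as [e Tpsi].
  (* [1 / ze + psi ze = a 2] would mean [1 / f ze = 0]. *)
  assert (Hcov : ~ covered psi 1 (a 2%nat)).
  { intros [ze [[Hz0 _] [Hz1 E]]].
    assert (Hzn : ze <> 0) by now apply Cmod_gt_0. pose proof (Hp ze Hz1) as Hn.
    assert (E' : / ze = q ze / p ze).
    { replace (q ze / p ze) with (a 2%nat - psi ze) by (unfold psi; ring). rewrite <- E. ring. }
    assert (E2 : p ze = ze * q ze).
    { replace (p ze) with (ze * p ze * / ze) by (field; auto). rewrite E'. field. auto. }
    unfold p in E2. apply C1_nz. replace (RtoC 1) with (1 + ze * q ze - ze * q ze) by ring.
    rewrite E2. ring. }
  destruct (omitted_bound psi (a 2%nat) c0 e Hpsi Hlip Tpsi Hcov) as [B1 B2].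
  split; [now apply (taylor2_bound_1 om c0 c1 c2)|].
  split; [now apply (taylor2_bound_2 om c0 c1 c2)|]. split; auto.
  now replace (a 2%nat ^ 2 - c0) with (a 3%nat) in B2 by (unfold c0; ring).
Qed.

Lemma class_U_bounds f a : class_U f -> has_expansion f a ->
  (Cmod (a 4%nat - a 2%nat ^ 3) <= 4)%R /\ (Cmod (a 5%nat - a 2%nat ^ 4) <= 11)%R.
Proof.
  intros HU Ha. pose proof (class_U_coefficients f a HU Ha) as [B1 [B2 [B3 B4]]].
  revert B1 B2 B3 B4.
  set (a2 := a 2%nat). set (a3 := a 3%nat). set (a4 := a 4%nat). set (a5 := a 5%nat).
  set (c0 := a2 ^ 2 - a3). set (c1 := _ - 2 * a2 ^ 3). set (c2 := _ - 3 * a5).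
  intros B1 B2 B3 B4.
  assert (H2 : RtoC 2 <> 0) by (intros E; apply RtoC_inj in E; lra).
  assert (H3 : RtoC 3 <> 0) by (intros E; apply RtoC_inj in E; lra).
  pose proof (Cmod_ge_0 c0) as P0. pose proof (Cmod_ge_0 c1) as P1.
  assert (X : (Cmod c0 <= 1)%R) by nra.
  split.
  - replace (a4 - a2 ^ 3) with (- (2 * a2 * c0 + c1 / 2)) by (unfold c0, c1; field; auto).
    rewrite Cmod_opp. eapply Rle_trans. apply Cmod_triangle.
    rewrite !Cmod_mult, Cmod_div, !Cmod_R, !Rabs_pos_eq by (auto; lra).
    assert (Cmod a2 * Cmod c0 <= 2 * Cmod c0)%R by (apply Rmult_le_compat_r; auto). nra.
  - replace (a5 - a2 ^ 4) with (- (3 * a3 * c0 + 2 * c0 ^ 2 + a2 * c1 + c2 / 3))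
      by (unfold c0, c1, c2; field; auto).
    rewrite Cmod_opp. eapply Rle_trans. apply Cmod_triangle.
    eapply Rle_trans. apply Rplus_le_compat_r. apply Cmod_triangle.
    eapply Rle_trans. apply Rplus_le_compat_r, Rplus_le_compat_r. apply Cmod_triangle.
    rewrite !Cmod_mult, Cmod_div, Cmod_pow, !Cmod_R, !Rabs_pos_eq by (auto; lra).
    assert (Cmod a3 * Cmod c0 <= 3 * Cmod c0)%R by (apply Rmult_le_compat_r; auto).
    assert (Cmod a2 * Cmod c1 <= 2 * Cmod c1)%R by (apply Rmult_le_compat_r; auto). nra.
Qed.

(** * The Koebe function and its rotations *)

(** Both sums have the same derivatives, and the value at 0 of the derived series shows
    the next coefficient. *)
Lemma Cpseries_injective n : forall a b : nat -> C, disk_coeffs a -> disk_coeffs b ->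
  (forall z, unit_disk z -> Cpseries a z = Cpseries b z) -> a n = b n.
Proof.
  induction n as [|n IH]; intros a b Ha Hb E.
  - rewrite <- (Cpseries_0 a), <- (Cpseries_0 b) by auto. apply E, disk_0.
  - assert (E1 : deriv_coeffs a n = deriv_coeffs b n).
    { apply IH; auto using disk_coeffs_deriv. intros z Hz.
      rewrite <- (Cder_unique _ _ _ (Cpseries_der a z Ha Hz)). apply Cder_unique.
      unfold unit_disk in Hz. assert (Hr : (0 < 1 - Cmod z)%R) by lra.
      apply Cder_ext_loc with (Cpseries b) (mkposreal _ Hr).
      - intros w Hw. symmetry. apply E. simpl in Hw.
        pose proof (Cmod_triangle_rev w z). unfold unit_disk. lra.
      - now apply Cpseries_der. }
    unfold deriv_coeffs in E1.
    assert (HN : RtoC (INR (S n)) <> 0).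
    { intros H. apply RtoC_inj in H. now apply (not_0_INR (S n)). }
    replace (a (S n)) with (/ INR (S n) * (INR (S n) * a (S n))) by (field; auto).
    rewrite E1. field. auto.
Qed.

Lemma has_expansion_unique f a b n : has_expansion f a -> has_expansion f b -> a n = b n.
Proof.
  intros Ha Hb. apply Cpseries_injective; eauto using has_expansion_disk_coeffs.
  intros z Hz. now rewrite <- (has_expansion_CS f a), <- (has_expansion_CS f b).
Qed.

Lemma one_minus_neq_0 z : unit_disk z -> 1 - z <> 0.
Proof.
  unfold unit_disk. intros Hz. apply Cmod_gt_0.
  pose proof (Cmod_triangle_rev 1 z). rewrite Cmod_1 in H. lra.
Qed.

Lemma disk_coeffs_one : disk_coeffs (fun _ => 1).
Proof.
  apply disk_coeffs_conv. intros x Hx.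
  apply (Cser_abs _ (fun n => x ^ n)%R).
  - intros n. rewrite Cmult_1_l, Cmod_pow, Cmod_R, Rabs_pos_eq; lra.
  - apply ex_series_geom. rewrite Rabs_pos_eq; lra.
Qed.

Lemma Cpseries_one z : unit_disk z -> Cpseries (fun _ => 1) z = / (1 - z).
Proof.
  intros Hz. pose proof (one_minus_neq_0 z Hz) as Hn.
  pose proof (Cpseries_shift _ z disk_coeffs_one Hz) as E.
  change (shift_coeffs (fun _ => 1)) with (fun _ : nat => RtoC 1) in E.
  set (s := Cpseries (fun _ => 1) z) in *.
  replace s with ((s - z * s) / (1 - z)) by (field; auto).
  rewrite E at 1. field. auto.
Qed.

Lemma Cpseries_one_deriv z : unit_disk z -> Cpseries (deriv_coeffs (fun _ => 1)) z = / (1 - z) ^ 2.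
Proof.
  intros Hz. pose proof (one_minus_neq_0 z Hz) as Hn.
  rewrite <- (Cder_unique _ _ _ (Cpseries_der _ z disk_coeffs_one Hz)). apply Cder_unique.
  unfold unit_disk in Hz. assert (Hr : (0 < 1 - Cmod z)%R) by lra.
  apply Cder_ext_loc with (fun w => / (1 - w)) (mkposreal _ Hr).
  - intros w Hw. symmetry. apply Cpseries_one. simpl in Hw.
    pose proof (Cmod_triangle_rev w z). unfold unit_disk. lra.
  - replace (/ (1 - z) ^ 2) with (- (0 - 1) / (1 - z) ^ 2) by (field; auto).
    apply (Cder_inv_comp (fun w => 1 - w)); auto.
    apply (Cder_minus (fun _ => 1) (fun w => w)). apply Cder_const. apply Cder_id.
Qed.

Lemma koebe_series z : unit_disk z -> Cser (fun n => RtoC (INR n) * z ^ n) (koebe z).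
Proof.
  intros Hz. pose proof (one_minus_neq_0 z Hz) as Hn.
  replace (koebe z) with (RtoC (INR 0) * z ^ 0 + z * / (1 - z) ^ 2)
    by (unfold koebe; simpl; field; auto).
  apply (Cser_incr (fun n => RtoC (INR n) * z ^ n)).
  apply Cser_ext with (fun n => z * (deriv_coeffs (fun _ => 1) n * z ^ n)).
  - intros n. unfold deriv_coeffs. rewrite Cpow_S. ring.
  - apply Cser_scal. rewrite <- Cpseries_one_deriv by auto. apply Cpseries_correct; auto.
    apply disk_coeffs_deriv, disk_coeffs_one.
Qed.

Lemma koebe_expansion : has_expansion koebe (fun n => RtoC (INR n)).
Proof.
  split; [reflexivity|]. split; [reflexivity|].
  intros z Hz. apply is_pseries_Cser. now apply koebe_series.
Qed.

Lemma Cmod_cis t : Cmod (cis t) = 1%R.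
Proof.
  replace (cis t) with (circ 1 t). apply Cmod_circ. lra.
  unfold circ, cis. now rewrite !Rmult_1_l.
Qed.

Lemma cis_opp t : cis (- t) * cis t = 1.
Proof.
  unfold cis. rewrite cos_neg, sin_neg.
  pose proof (sin2_cos2 t) as E. unfold Rsqr in E.
  apply injective_projections; simpl; [rewrite <- E|]; ring.
Qed.

Lemma cis_mult_disk t z : unit_disk z -> unit_disk (cis t * z).
Proof. unfold unit_disk. now rewrite Cmod_mult, Cmod_cis, Rmult_1_l. Qed.

Lemma rotation_koebe_expansion t :
  has_expansion (rotation t koebe) (fun n => cis (- t) * (RtoC (INR n) * cis t ^ n)).
Proof.
  split; [simpl; ring|]. split.
  { etransitivity; [|apply (cis_opp t)]. simpl. ring. }
  intros z Hz. apply is_pseries_Cser.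
  apply Cser_ext with (fun n => cis (- t) * (RtoC (INR n) * (cis t * z) ^ n)).
  - intros n. rewrite Cpow_mult_l. ring.
  - apply Cser_scal. apply koebe_series. now apply cis_mult_disk.
Qed.

Lemma koebe_der z : unit_disk z -> Cder koebe z ((1 + z) / (1 - z) ^ 3).
Proof.
  intros Hz. pose proof (one_minus_neq_0 z Hz) as Hn.
  replace ((1 + z) / (1 - z) ^ 3) with
    (1 * / (1 - z) ^ 2 + z * (- ((0 - 1) * (1 - z) + (1 - z) * (0 - 1)) / ((1 - z) ^ 2) ^ 2))
    by (field; auto).
  apply (Cder_mult (fun z => z) (fun z => / (1 - z) ^ 2)). apply Cder_id.
  apply (Cder_inv_comp (fun z => (1 - z) ^ 2)); [|now apply Cpow_nz].
  assert (D1 : Cder (fun z => 1 - z) z (0 - 1)).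
  { apply (Cder_minus (fun _ => 1) (fun z => z)). apply Cder_const. apply Cder_id. }
  assert (He : forall w, (1 - w) * (1 - w) = (1 - w) ^ 2) by (intros w; ring).
  apply (Cder_ext_loc (fun z => (1 - z) * (1 - z)) _ _ _ (mkposreal 1 Rlt_0_1)); auto.
  now apply (Cder_mult (fun z => 1 - z) (fun z => 1 - z)).
Qed.

Lemma rotation_koebe_class_U t : class_U (rotation t koebe).
Proof.
  assert (Hv : cis t <> 0) by (apply Cmod_gt_0; rewrite Cmod_cis; lra).
  assert (Ev : cis (- t) = / cis t).
  { replace (cis (- t)) with (cis (- t) * cis t * / cis t) by (field; auto).
    rewrite cis_opp. ring. }
  assert (HD : forall z, unit_disk z -> Cder (rotation t koebe) z
    ((1 + cis t * z) / (1 - cis t * z) ^ 3)).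
  { intros z Hz. pose proof (cis_mult_disk t z Hz) as Hz'.
    pose proof (one_minus_neq_0 _ Hz') as Hn.
    replace ((1 + cis t * z) / (1 - cis t * z) ^ 3) with
      (0 * koebe (cis t * z) + cis (- t) * ((0 * z + cis t * 1) *
         ((1 + cis t * z) / (1 - cis t * z) ^ 3))) by (rewrite Ev; field; auto).
    apply (Cder_mult (fun _ => cis (- t)) (fun z => koebe (cis t * z))). apply Cder_const.
    apply (Cder_comp (fun z => cis t * z) koebe); [|now apply koebe_der].
    apply (Cder_mult (fun _ => cis t) (fun z => z)). apply Cder_const. apply Cder_id. }
  split; [split|split].
  - intros z Hz. eexists. apply Cder_is_derive. now apply HD.
  - eexists. apply rotation_koebe_expansion.
  - intros z Hz Hz0. pose proof (one_minus_neq_0 _ (cis_mult_disk t z Hz)) as Hn.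
    unfold rotation, koebe. rewrite Ev. unfold Cdiv.
    assert (Hi : forall w, w <> 0 -> / w <> 0).
    { intros w Hw E. apply C1_nz. rewrite <- (Cinv_r w Hw), E. ring. }
    repeat apply Cmult_neq_0; auto. apply Hi. now apply Cpow_nz.
  - intros z Hz. pose proof (one_minus_neq_0 _ (cis_mult_disk t z Hz)) as Hn.
    rewrite (Cder_unique _ _ _ (HD z Hz)).
    assert (Ez : z_over (rotation t koebe) z = (1 - cis t * z) ^ 2).
    { unfold z_over. destruct (Ceq_dec z 0) as [->|Hz0]. ring.
      unfold rotation, koebe. rewrite Ev. field. auto. }
    rewrite Ez.
    replace (((1 - cis t * z) ^ 2) ^ 2 * ((1 + cis t * z) / (1 - cis t * z) ^ 3) - 1)
      with (- (cis t * z) ^ 2) by (field; auto).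
    unfold unit_disk in Hz. pose proof (Cmod_ge_0 z).
    replace (- (cis t * z) ^ 2) with (- ((cis t * z) ^ 2)) by ring.
    rewrite Cmod_opp, Cmod_pow, Cmod_mult, Cmod_cis, Rmult_1_l. nra.
Qed.

Lemma rotation_koebe_extremal t a : has_expansion (rotation t koebe) a ->
  Cmod (a 4%nat - a 2%nat ^ 3) = 4%R /\ Cmod (a 5%nat - a 2%nat ^ 4) = 11%R.
Proof.
  intros Ha.
  rewrite !(has_expansion_unique _ _ _ _ Ha (rotation_koebe_expansion t)).
  set (v := cis (- t)). set (w := cis t).
  assert (E : v * w = 1) by apply cis_opp.
  assert (Hw : Cmod w = 1%R) by apply Cmod_cis.
  rewrite !INR_IZR_INZ. simpl IZR. split.
  - replace (v * (RtoC 4 * w ^ 4) - (v * (RtoC 2 * w ^ 2)) ^ 3) with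
      (4 * (v * w) * w ^ 3 - 8 * (v * w) ^ 3 * w ^ 3) by ring.
    rewrite E. replace (4 * 1 * w ^ 3 - 8 * 1 ^ 3 * w ^ 3) with (- (4 * w ^ 3)) by ring.
    rewrite Cmod_opp, Cmod_mult, Cmod_pow, Hw, Cmod_R, Rabs_pos_eq, pow1; lra.
  - replace (v * (RtoC 5 * w ^ 5) - (v * (RtoC 2 * w ^ 2)) ^ 4) with
      (5 * (v * w) * w ^ 4 - 16 * (v * w) ^ 4 * w ^ 4) by ring.
    rewrite E. replace (5 * 1 * w ^ 4 - 16 * 1 ^ 4 * w ^ 4) with (- (11 * w ^ 4)) by ring.
    rewrite Cmod_opp, Cmod_mult, Cmod_pow, Hw, Cmod_R, Rabs_pos_eq, pow1; lra.
Qed.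

Lemma rotation_0 F : rotation 0 F = F.
Proof.
  assert (E : cis 0 = 1) by (unfold cis; now rewrite cos_0, sin_0).
  apply functional_extensionality. intros z. unfold rotation.
  rewrite Ropp_0, E, !Cmult_1_l. reflexivity.
Qed.

Local Close Scope C_scope.

Theorem theorem3 :
  (forall (f : C -> C) (a : nat -> C),
     class_U f -> has_expansion f a ->
     (Cmod (a 4%nat - a 2%nat ^ 3)%C <= 4)%R /\
     (Cmod (a 5%nat - a 2%nat ^ 4)%C <= 11)%R) /\
  has_expansion koebe (fun n : nat => RtoC (INR n)) /\
  (class_U koebe /\
   forall a : nat -> C, has_expansion koebe a ->
     Cmod (a 4%nat - a 2%nat ^ 3)%C = 4%R /\
     Cmod (a 5%nat - a 2%nat ^ 4)%C = 11%R) /\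
  (forall theta : R,
     class_U (rotation theta koebe) /\
     forall a : nat -> C, has_expansion (rotation theta koebe) a ->
       Cmod (a 4%nat - a 2%nat ^ 3)%C = 4%R /\
       Cmod (a 5%nat - a 2%nat ^ 4)%C = 11%R).
Proof.
  split; [exact class_U_bounds|]. split; [exact koebe_expansion|]. split.
  - rewrite <- (rotation_0 koebe). split.
    + apply rotation_koebe_class_U.
    + exact (rotation_koebe_extremal 0).
  - intros theta. split.
    + apply rotation_koebe_class_U.
    + exact (rotation_koebe_extremal theta).
Qed.
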